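(* Let $k\ge 2$ be an integer and let $X_1,\dots,X_n$ be i.i.d. random variables with a $k$-monotone density $f_0\in\mathcal{M}_k$. Let $X_{(1)}\le\dots\le X_{(n)}$ denote their order statistics. Then with probability $1$ the following holds. The maximum likelihood estimator $\hat f_n$ over $\mathcal{M}_k$ exists and is unique, and it is defined by a discrete mixing probability measure $\hat G_n$, which is uniquely determined. The cardinality of the support $\operatorname{supp}(\hat G_n)$ is at most $n$. If $\operatorname{supp}(\hat G_n)$ consists of the points $Y_1<\dots<Y_m$ with $m<n$, then there exist indices $1\le i_1<\dots<i_m\le n$, with $X_{(i_1)}<\dots<X_{(i_m)}$, such that $$X_{(i_j)}<Y_j<X_{(i_{j+k})}\qquad\text{for all } 1\le j\le m,$$ where by convention $X_{(i_l)}=+\infty$ for $l>m$. Also, the largest point $Y_m$ of $\operatorname{supp}(\hat G_n)$ satisfies $Y_m>X_{(n)}$.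
   Context: For a positive integer $k$, let $g_0(x)=k(1-x)_+^{k-1}$ for $x\ge 0$, where $t_+=\max(t,0)$. The class $\mathcal{M}_k$ of $k$-monotone densities on $\mathbb{R}_+$ is the set of all functions of the form $$f(x)=\int_0^{+\infty}\frac1y\,g_0\!\left(\frac{x}{y}\right)dG(y)=\int_0^{+\infty}\frac{k(y-x)_+^{k-1}}{y^k}\,dG(y),$$ where $G$ is a probability measure on $(0,+\infty)$; $G$ is called the mixing probability measure defining $f$. Given observations $X_1,\dots,X_n$, a maximum likelihood estimator (MLE) over $\mathcal{M}_k$ is any $\hat f_n\in\mathcal{M}_k$ that maximizes $\prod_{i=1}^n f(X_i)$ over all $f\in\mathcal{M}_k$. *)

(* Defs.v *)
From HB Require Import structures.
From mathcomp Require Import all_boot all_order all_algebra.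
From mathcomp Require Import all_classical all_reals all_analysis.

Set Implicit Arguments.
Unset Strict Implicit.
Unset Printing Implicit Defensive.

Import Order.TTheory GRing.Theory Num.Theory.
Import numFieldNormedType.Exports.

Local Open Scope classical_set_scope.
Local Open Scope ring_scope.

(* As [0 ^+ 0 = 1], this is the intended kernel only for [2 <= k]. *)
Definition g0 (R : realType) (k : nat) (x : R) : R :=
  k%:R * Num.max (1 - x) 0 ^+ k.-1.

(* Probability measures on (0, +oo) are encoded as Borel probability measures
   on the line that give mass 1 to (0, +oo). *)
Definition mixing (R : realType) (G : probability (measurableTypeR R) R) : Prop :=
  G [set` `]0%R, +oo[] = 1%E.

(* A density on R_+ is extended by 0 to the negative half-line, so that equality
   of functions on R is equality on R_+.  Values are extended reals because
   [f 0 = \int k / y dG(y)] may be infinite; [f x] is finite for [0 < x]. *)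
Definition mixture (R : realType) (k : nat)
    (G : probability (measurableTypeR R) R) (x : R) : \bar R :=
  if 0 <= x then (\int[G]_(y in `]0%R, +oo[) (y^-1 * g0 k (x / y))%:E)%E else 0%E.

Definition kmonotone (R : realType) (k : nat) : set (R -> \bar R) :=
  [set f | exists2 G : probability (measurableTypeR R) R,
             mixing G & f = mixture k G].

Definition is_mle (R : realType) (k n : nat) (x : 'I_n -> R)
    (f : R -> \bar R) : Prop :=
  kmonotone k f /\
  forall g : R -> \bar R, kmonotone k g ->
    (\prod_(i < n) g (x i) <= \prod_(i < n) f (x i))%E.

Definition discrete_measure (R : realType)
    (G : probability (measurableTypeR R) R) : Prop :=
  exists2 D : set R, countable D & G (~` D) = 0%E.

Definition msupport (R : realType)
    (G : probability (measurableTypeR R) R) : set R :=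
  [set y : R | forall U : set R, open U -> U y -> (0 < G U)%E].

(* Indices start at 0: the i-th smallest value of [x] is
   [order_stat x] at the ordinal of value [i - 1]. *)
Definition order_stat (R : realType) (n : nat) (x : 'I_n -> R) (i : 'I_n) : R :=
  nth 0 (sort <=%R (codom x)) i.

(* X_(i_l), with the convention that it is +oo when the index l is beyond the
   last one. *)
Definition order_stat_sub (R : realType) (n m : nat) (x : 'I_n -> R)
    (i : 'I_m -> 'I_n) (l : nat) : \bar R :=
  if insub l is Some l' then (order_stat x (i l'))%:E else +oo%E.

Definition mutually_independent (d : measure_display) (T : measurableType d)
    (R : realType) (P : probability T R) (n : nat)
    (X : 'I_n -> {RV P >-> measurableTypeR R}) : Prop :=
  forall (J : {set 'I_n}) (A : 'I_n -> set (measurableTypeR R)),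
    (forall i, measurable (A i)) ->
    P (\bigcap_(i in [set` J]) (X i @^-1` A i)) =
      (\prod_(i in J) P (X i @^-1` A i))%E.

Definition has_density (d : measure_display) (T : measurableType d)
    (R : realType) (P : probability T R) (X : {RV P >-> measurableTypeR R})
    (f : R -> \bar R) : Prop :=
  forall A : set (measurableTypeR R), measurable A ->
    distribution P X A = (\int[lebesgue_measure]_(x in A) f x)%E.

(* Main.v *)
Require Import Defs.
From HB Require Import structures.
From mathcomp Require Import all_boot all_order all_algebra.
From mathcomp Require Import all_classical all_reals all_analysis.
From mathcomp Require Import measurable_realfun ring lra zify.
From mathcomp.real_closed Require polyrcf.

Set Implicit Arguments.
Unset Strict Implicit.
Unset Printing Implicit Defensive.

Import Order.TTheory GRing.Theory Num.Theory.
Import numFieldNormedType.Exports.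

Local Open Scope classical_set_scope.
Local Open Scope ring_scope.

(* With [u = 1 / y], the kernel values at the data trace a compact curve in R^n,
   and the likelihood is the product of the coordinates of a point of its convex
   hull.  A maximiser p exists by compactness, and its optimality condition reads
   D(y) := sum_i K(x_i, y) / p_i <= n for all y > 0.  Integrating D against a
   mixing measure, the arithmetic-geometric mean inequality shows that p is the
   only vector of values of a maximum likelihood estimator, and that the mixing
   measure of such an estimator is carried by the contact set {D = n}.

   Up to the factor y^k, n - D is the nonnegative spline
   H(y) = n y^k - k sum_i (y - x_i)_+^(k-1) / p_i, which vanishes on the contact
   set.  Rolle's theorem, applied to the oscillations of H between its zeros,
   forces many data points below and between contact points; conversely, a spline
   sum_j c_j (Y_j - x)_+^(k-1) with knots at m contact points that vanishes at all
   data points would have more sign changes in its last derivative than its knots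
   allow.  Hence the vectors K(., Y_j) are linearly independent.  This bounds the
   number of contact points by n and determines the weights.  Some m x m minor of
   (Y_j - x_i)_+^(k-1) is then nonzero, and a minor whose indices violate one of
   the interlacing inequalities would vanish for rank reasons. *)

(** * Alternating sequences and splines *)

Lemma ltnS_case (i r : nat) : (i < r.+1)%N -> i = r \/ (i < r)%N.
Proof. by rewrite ltnS leq_eqVlt => /predU1P. Qed.

Section Alternation.
Variable R : realType.
Implicit Types (F : R -> R) (e : R) (r : nat) (s : nat -> R).

(* The part of "[dF] is the derivative of [F]" that survives at the kinks of a
   spline. *)
Definition sign_derivative F dF := forall e (s t : R), s < t ->
  0 < e * (F t - F s) -> exists u : R, s < u < t /\ 0 < e * dF u.

(** Only the sign of the real [e] matters: it is the sign of the first value, or of the first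
    increment. [alternating] counts values and [zigzag] increments, so a zigzag of length [r] has
    [r + 1] points. *)
Definition alternating F e r s :=
  (forall i, (i.+1 < r)%N -> s i < s i.+1) /\
  (forall i, (i < r)%N -> 0 < e * (-1) ^+ i * F (s i)).

Definition zigzag F e r s :=
  (forall i, (i < r)%N -> s i < s i.+1) /\
  (forall i, (i < r)%N -> 0 < e * (-1) ^+ i * (F (s i.+1) - F (s i))).

(** The Rolle step: each increment gives, strictly inside its interval, a value of the derivative of
    the same sign, and these intervals follow one another. *)
Lemma zigzag_alternating F dF e r s : sign_derivative F dF -> zigzag F e r s ->
  exists s', alternating dF e r s' /\
    forall i, (i < r)%N -> s i < s' i < s i.+1.
Proof.
move=> FdF [s_incr zz].
have /choice[s' s'P] : forall i, exists u, (i < r)%N ->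
    s i < u < s i.+1 /\ 0 < e * (-1) ^+ i * dF u.
  move=> i; case: (ltnP i r) => [ir|_]; last by exists 0.
  by have [u uP] := FdF _ _ _ (s_incr i ir) (zz i ir); exists u.
exists s'; split; last by move=> i /s'P[].
split=> [i ir|i /s'P[]//].
have [/andP[_ h] _] := s'P _ (ltnW ir); have [/andP[h' _] _] := s'P _ ir.
exact: lt_trans h h'.
Qed.

Lemma alternating_homo F e r s i j : alternating F e r s ->
  (i < j < r)%N -> s i < s j.
Proof.
move=> [s_incr _]; elim: j => // j IH /andP[]; rewrite ltnS leq_eqVlt.
case/predU1P=> [->|ij] jr; first exact: s_incr.
by apply: lt_trans (s_incr _ jr); apply: IH; rewrite ij ltnW.
Qed.

Lemma alternating_zigzag F e r s : alternating F e r.+1 s -> zigzag F (- e) r s.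
Proof.
move=> [s_incr alt]; split=> [i ir|i ir]; first exact: s_incr.
have := alt i (leqW ir); have := alt i.+1 ir; rewrite exprS; lra.
Qed.

(** A zero to the left of all points adds an increment, which makes up for the one lost in passing
    from values to increments. *)
Lemma alternating_zigzag_left F e r s A : alternating F e r s ->
  F A = 0 -> ((0 < r)%N -> A < s 0%N) ->
  zigzag F e r (fun i => if i is j.+1 then s j else A).
Proof.
move=> [s_incr alt] FA As; split=> -[|i] ir.
- exact: As.
- exact: s_incr.
- by rewrite FA subr0; apply: alt.
- have := alt i (ltnW ir); have := alt i.+1 ir; rewrite exprS; lra.
Qed.

Lemma zigzag_right F e r s B : zigzag F e r s -> (0 < r)%N ->
  0 < e * (-1) ^+ r.-1 * F (s r) -> F B = 0 -> s r < B ->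
  zigzag F e r.+1 (fun i => if (i <= r)%N then s i else B).
Proof.
move=> [s_incr zz] r0 Fs FB sB; split=> i /ltnS_case[->|ir].
- by rewrite /= leqnn ltnn.
- by rewrite /= (ltnW ir) ir; apply: s_incr.
- rewrite /= leqnn ltnn FB; case: r r0 Fs {zz s_incr sB} => // r _ /=.
  by rewrite exprS; lra.
- by rewrite /= (ltnW ir) ir; apply: zz.
Qed.

Variable D : nat -> R -> R.
Hypothesis DP : forall p, sign_derivative (D p.+1) (D p).

(** The zeros at [A] in the orders 1 to [p] compensate the loss in each Rolle step, so both the
    count and the leading sign survive down to order 0. *)
Lemma alternating_chain_left p e r s A B :
  (forall j, (0 < j <= p)%N -> D j A = 0) ->
  alternating (D p) e r s -> (forall i, (i < r)%N -> A < s i < B) ->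
  exists s', alternating (D 0) e r s' /\ forall i, (i < r)%N -> A < s' i < B.
Proof.
elim: p s => [|p IH] s DA alt sAB; first by exists s.
have As : (0 < r)%N -> A < s 0%N by move=> /sAB/andP[].
have zz := alternating_zigzag_left alt (DA p.+1 (leqnn _)) As.
have [s' [alt' s'P]] := zigzag_alternating (@DP p) zz.
apply: (IH s') => // [j /andP[j0 jp]|i ir]; first by apply: DA; rewrite j0 leqW.
have /andP[h1 h2] := s'P i ir; apply/andP; split.
  by apply: le_lt_trans h1; case: (i) ir => // j jr; case/andP: (sAB j (ltnW jr)) => /ltW.
by apply: lt_trans h2 _; case/andP: (sAB i ir).
Qed.

(** With zeros at both ends each Rolle step gains a value: [r] values have [r - 1] increments, and
    each end adds one. *)
Lemma alternating_chain_both p e r s A B :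
  (forall j, (0 < j <= p)%N -> D j A = 0) ->
  (forall j, (0 < j <= p)%N -> D j B = 0) -> (0 < r)%N ->
  alternating (D p) e r s -> (forall i, (i < r)%N -> A < s i < B) ->
  exists s', alternating (D 0) e (r + p) s' /\
    forall i, (i < r + p)%N -> A < s' i < B.
Proof.
elim: p r s => [|p IH] r s DA DB r0 alt sAB; first by exists s; rewrite addn0.
have As : (0 < r)%N -> A < s 0%N by move=> /sAB/andP[].
have zz := alternating_zigzag_left alt (DA p.+1 (leqnn _)) As.
case: r r0 alt sAB As zz => // r _ alt sAB As zz.
have /andP[_ rB] := sAB r (leqnn _).
have := zigzag_right zz isT (alt.2 r (leqnn _)) (DB p.+1 (leqnn _)) rB.
move=> /(zigzag_alternating (@DP p))[s' [alt' s'P]].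
have := IH r.+2 s'; rewrite addSnnS; apply=> //.
- by move=> j /andP[j0 jp]; apply: DA; rewrite j0 leqW.
- by move=> j /andP[j0 jp]; apply: DB; rewrite j0 leqW.
move=> i ir; have /andP[h1 h2] := s'P i ir; apply/andP; split.
  apply: le_lt_trans h1; rewrite -ltnS ir; case: i ir {h2} => // j jr.
  by case/andP: (sAB j jr) => /ltW.
apply: (lt_le_trans h2); case: ifP => [ir'|//].
by case/andP: (sAB i ir') => _ /ltW.
Qed.

(** Without zeros at the ends each Rolle step costs one value and flips the leading sign. *)
Lemma alternating_chain p e r s A B :
  alternating (D p) e (r + p) s -> (forall i, (i < r + p)%N -> A < s i < B) ->
  exists s', alternating (D 0) ((-1) ^+ p * e) r s' /\
    forall i, (i < r)%N -> A < s' i < B.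
Proof.
elim: p e s => [|p IH] e s alt sAB; first by exists s; rewrite mul1r -(addn0 r).
rewrite addnS in alt sAB.
have [s' [alt' s'P]] := zigzag_alternating (@DP p) (alternating_zigzag alt).
have := IH (- e) s'; rewrite exprS mulrN mulN1r mulNr; apply=> // i ir.
have /andP[h1 h2] := s'P i ir; apply/andP; split.
  by apply: lt_trans h1; case/andP: (sAB i (leqW ir)).
by apply: lt_trans h2 _; case/andP: (sAB i.+1 ir).
Qed.

(* Of two consecutive values of opposite signs, one always has the sign needed
   to prolong an alternating sequence. *)
Lemma alternating_select F (u v : nat -> R) N :
  (forall i, (i <= N)%N -> u i < v i /\ F (u i) * F (v i) < 0) ->
  (forall i, (i < N)%N -> v i < u i.+1) ->
  exists e s, [/\ alternating F e N.+2 s, u 0%N <= s 0%N & s N.+1 <= v N].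
Proof.
elim: N => [|N IH] uvP vu.
  have [uv0 Fuv] := uvP 0%N isT.
  exists (F (u 0%N)), (fun i => if i is 0 then u 0%N else v 0%N); split=> //.
  split=> [[|i]//|[|[|i]]// _]; rewrite ?expr0 ?expr1; last by nra.
  rewrite mulr1 -expr2 exprn_even_gt0//=.
  by apply/eqP => F0; rewrite F0 mul0r ltxx in Fuv.
have [||e [s [[s_incr alt] us sv]]] := IH.
- by move=> i iN; apply: uvP; rewrite leqW.
- by move=> i iN; apply: vu; rewrite leqW.
have [uvN Fuv] := uvP N.+1 (leqnn _).
have vuN := vu N (leqnn _).
have [w [uw wv Fw]] : exists w, [/\ u N.+1 <= w, w <= v N.+1 &
    0 < e * (-1) ^+ N.+2 * F w].
  set c := e * _.
  have c0 : c != 0.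
    apply/eqP => c0; have := alt N.+1 (leqnn _).
    by move: c0; rewrite /c exprS mulN1r mulrN => /eqP; rewrite oppr_eq0 => /eqP->; rewrite mul0r ltxx.
  have [cu|cu] := ltP 0 (c * F (u N.+1)); first by exists (u N.+1); split=> //; apply: ltW.
  exists (v N.+1); split=> //; first exact: ltW.
  have c2 : 0 < c ^+ 2 by rewrite exprn_even_gt0.
  have cc : c ^+ 2 * (F (u N.+1) * F (v N.+1)) < 0 by rewrite pmulr_rlt0.
  have : (c * F (u N.+1)) * (c * F (v N.+1)) < 0.
    by move: cc; congr (_ < _); ring.
  have [//|cv] := ltP 0 (c * F (v N.+1)).
  by have := mulr_le0 cu cv; lra.
exists e, (fun i => if (i <= N.+1)%N then s i else w); split=> /=.
- split=> i /ltnS_case[|iN].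
  + move=> [->]; rewrite leqnn ltnn.
    by apply: (le_lt_trans sv); apply: (lt_le_trans vuN).
  + by rewrite (ltnW iN : (i <= N.+1)%N) (iN : (i < N.+1)%N); apply: s_incr.
  + by move=> ->; rewrite ltnn.
  + by rewrite -ltnS iN; apply: alt.
- by [].
- by rewrite ltnn.
Qed.

End Alternation.

(** * Truncated-power splines and their polynomial pieces *)

Section Spline.
Variables (R : realType) (I : finType) (q : R) (a x : I -> R).

(* Unlike [Num.max y 0 ^+ p], this is the Heaviside function for [p = 0]. *)
Definition tpow (p : nat) (y : R) : R := if 0 <= y then y ^+ p else 0.

Lemma tpow_max p (y : R) : (0 < p)%N -> tpow p y = Num.max y 0 ^+ p.
Proof.
move=> p0; rewrite /tpow; case: (leP 0 y) => // _.
by rewrite expr0n eqn0Ngt p0.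
Qed.

(* The factorials make [spline p] the derivative of [spline p.+1] off the
   knots. *)
Definition spline (p : nat) (y : R) : R :=
  q * y ^+ p.+1 / (p.+1)`!%:R + \sum_i a i * tpow p (y - x i) / p`!%:R.

(** The polynomial that the spline follows from [s] up to the next knot. *)
Definition spline_poly (s : R) (p : nat) : {poly R} :=
  (q / (p.+1)`!%:R) *: 'X^(p.+1) +
  \sum_(i | x i <= s) (a i / p`!%:R) *: ('X - (x i)%:P) ^+ p.

Let factS_div (p : nat) (c : R) : c / (p.+1)`!%:R *+ p.+1 = c / p`!%:R.
Proof.
by rewrite -[LHS]mulr_natr factS natrM invfM mulrA mulrAC mulfVK ?pnatr_eq0.
Qed.

Lemma deriv_spline_poly s p : (spline_poly s p.+1)^`() = spline_poly s p.
Proof.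
rewrite /spline_poly derivD derivZ derivXn -pred_Sn -scalerMnr scalerMnl factS_div.
congr (_ + _); rewrite raddf_sum; apply: eq_bigr => i _ /=.
by rewrite derivZ deriv_exp derivXsubC mul1r -scalerMnr scalerMnl factS_div.
Qed.


(** At [y = x i] the new term is still 0 when [p] is positive, whereas the Heaviside function of
    order 0 has already jumped; hence the two alternatives. *)
Lemma spline_polyE s p y : s <= y ->
  (forall i, s < x i -> y < x i \/ y <= x i /\ (0 < p)%N) ->
  spline p y = (spline_poly s p).[y].
Proof.
move=> sy xP; rewrite /spline /spline_poly hornerD hornerZ hornerXn mulrAC.
congr (_ + _); rewrite horner_sum [RHS]big_mkcond; apply: eq_bigr => i _.
case: ifPn => [xs|]; rewrite ?hornerE -?ltNge /tpow.
  by rewrite subr_ge0 (le_trans xs sy) mulrAC.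
move=> /xP[yx|[]]; first by rewrite leNgt subr_lt0 yx/= mulr0 mul0r.
rewrite le_eqVlt => /predU1P[-> p0|yx _]; last by rewrite leNgt subr_lt0 yx/= mulr0 mul0r.
by rewrite subrr lexx expr0n eqn0Ngt p0 mulr0 mul0r.
Qed.

(** Induction on the number of knots inside the interval. Without knots the mean value theorem for
    polynomials applies; otherwise the interval is cut at a knot, and one of the two increments has
    the required sign. *)
Lemma spline_sign_derivative p : sign_derivative (spline p.+1) (spline p).
Proof.
move=> e s t st; have [N] := ubnP #|[set i | s < x i < t]%SET|.
elim: N s t st => // N IH s t st.
have [[i si]|nokn] := pselect (exists i, s < x i < t); last first.
  have kn i : s < x i -> t <= x i.
    by move=> sx; rewrite leNgt; apply/negP => xt; apply: nokn; exists i; rewrite sx.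
  move=> _; rewrite !(@spline_polyE s) // ?ltW//; last 2 first.
  - by move=> i sx; left.
  - by move=> i /kn ?; right.
  have [c /[!in_itv]/= /andP[sc ct] ->] := polyrcf.poly_mvt (spline_poly s p.+1) st.
  rewrite mulrA pmulr_lgt0 ?subr_gt0// => h; exists c; rewrite sc ct; split=> //.
  rewrite deriv_spline_poly in h.
  rewrite (@spline_polyE s) ?ltW// => i /kn tx; left.
  exact: lt_le_trans tx.
have /andP[sx xt] := si; rewrite ltnS => card_le ex.
have [pos|neg] := ltP 0 (e * (spline p.+1 (x i) - spline p.+1 s)).
  have [|u [/andP[su ux] uP]] := IH s (x i) sx _ pos.
    apply: leq_trans card_le; apply/proper_card/properP; split.
      apply/fintype.subsetP => j; rewrite !inE => /andP[->/= h]; exact: lt_trans xt.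
    by exists i; rewrite !inE ?ltxx ?andbF.
  by exists u; rewrite su (lt_trans ux xt).
have pos : 0 < e * (spline p.+1 t - spline p.+1 (x i)) by lra.
have [|u [/andP[su ux] uP]] := IH (x i) t xt _ pos.
  apply: leq_trans card_le; apply/proper_card/properP; split.
    apply/fintype.subsetP => j; rewrite !inE => /andP[h ->]; rewrite andbT; exact: lt_trans h.
  by exists i; rewrite !inE ?ltxx ?andbF.
by exists u; rewrite ux (lt_trans sx su).
Qed.

(** At order 0 the spline is [q * y] plus a step function that is right-continuous at its jumps;
    hence the half-open condition on the knots. *)
Lemma spline0_no_knot (s t : R) : s <= t -> (forall i, ~~ (s < x i <= t)) ->
  spline 0 t = spline 0 s + q * (t - s).
Proof.
move=> st kn; rewrite /spline !divr1 !expr1.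
have -> : \sum_i a i * tpow 0 (t - x i) / 1 = \sum_i a i * tpow 0 (s - x i) / 1.
  apply: eq_bigr => i _; rewrite /tpow !subr_ge0 !expr0.
  suff -> : (x i <= t) = (x i <= s) by [].
  by apply/idP/idP => h; [have := kn i; rewrite h andbT -leNgt|exact: le_trans st].
ring.
Qed.

End Spline.

Section RootsOnInterval.
Variable R : realType.

Lemma poly_vanish_itv (P : {poly R}) (s t : R) : s < t ->
  (forall y, s < y < t -> P.[y] = 0) -> P = 0.
Proof.
move=> st P0.
(* Infinitely many roots; the shift to [i.+2] keeps them strictly below [t]. *)
pose f (i : nat) : R := s + (t - s) / i.+2%:R.
have finj : injective f.
  move=> i j /addrI /(mulfI _)-/(_ _)/invr_inj/eqP; rewrite eqr_nat => h.
  by apply: succn_inj; apply: succn_inj; apply/eqP/h; rewrite subr_eq0 gt_eqF.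
apply: (@roots_geq_poly_eq0 _ _ [seq f i | i <- iota 0 (size P)]).
- apply/allP => _ /mapP[i _ ->]; apply/eqP/P0; rewrite /f.
  have h : 0 < (t - s) / i.+2%:R by rewrite divr_gt0 ?subr_gt0// ltr0n.
  have : (t - s) / i.+2%:R < t - s.
    by rewrite ltr_pdivrMr ?ltr0n// ltr_pMr ?subr_gt0// ltr1n.
  by move: h; set z := _ / _; lra.
- by rewrite map_inj_uniq ?iota_uniq.
- by rewrite size_map size_iota.
Qed.

End RootsOnInterval.

(** * Knots forced by sign changes at order 0 *)

Section SplineKnots.
Variables (R : realType) (I : finType).
Implicit Types (q : R) (a x : I -> R).

Lemma next_knot x (s t : R) : s < t ->
  exists t', [/\ s < t', t' <= t & forall i, s < x i -> t' <= x i].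
Proof.
move=> st; exists (\big[Num.min/t]_(i | s < x i) x i); split.
- by apply: lt_bigmin.
- exact: bigmin_le_id.
- by move=> i si; apply: bigmin_le_cond.
Qed.

Lemma spline_vanish_itv q a x p (s t : R) : s < t ->
  (forall y, s < y < t -> spline q a x p y = 0) -> spline_poly q a x s p = 0.
Proof.
move=> st H0; have [t' [st' t't kn]] := next_knot x st.
apply: (poly_vanish_itv st') => y /andP[sy yt'].
rewrite -spline_polyE ?(ltW sy)// => [|i /kn h].
  by apply: H0; rewrite sy (lt_le_trans yt').
by left; exact: lt_le_trans h.
Qed.

Lemma spline_poly_eq0_le q a x s p j : (j <= p)%N ->
  spline_poly q a x s p = 0 -> spline_poly q a x s j = 0.
Proof.
elim: p => [|p IH]; first by rewrite leqn0 => /eqP->.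
rewrite leq_eqVlt => /predU1P[->//|]; rewrite ltnS => /IH h P0.
by apply: h; rewrite -deriv_spline_poly P0 deriv0.
Qed.

(** Differentiated down to order 0, the piece keeps the coefficient [q] in degree 1. *)
Lemma spline_poly_neq0 q a x s p : q != 0 -> spline_poly q a x s p != 0.
Proof.
apply: contraNneq => /(spline_poly_eq0_le (leq0n p))/(congr1 (fun P : {poly R} => P`_1)).
rewrite /spline_poly coefD coefZ coefXn eqxx mulr1 divr1 coef0 coef_sum big1 ?addr0 => [->//|i _].
by rewrite coefZ expr0 coef1 mulr0.
Qed.

(** The condition [q * A = 0] serves two cases: the contact function at [A = 0], and splines with
    [q = 0] at or before their first knot. *)
Lemma spline_left_eq0 q a x p (A : R) : q * A = 0 -> (forall i, A <= x i) ->
  (0 < p)%N -> spline q a x p A = 0.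
Proof.
move=> qA Ax p0; rewrite /spline exprS mulrA qA !mul0r add0r big1// => i _.
rewrite tpow_max// max_r ?subr_le0// expr0n eqn0Ngt p0/=.
by rewrite mulr0 mul0r.
Qed.

(** For [q = 0] the order-0 spline is constant between knots, so each of the [r] sign changes
    crosses a knot of its own. *)
Lemma crossing_count a x e r s : alternating (spline 0 a x 0) e r.+1 s ->
  (r <= #|[set i | (s 0%N < x i <= s r)%R]%SET|)%N.
Proof.
move=> alt.
have crossing j : (j < r)%N -> exists i, s j < x i <= s j.+1.
  move=> jr; apply: contrapT => /forallNP kn.
  have sj : s j <= s j.+1 by apply/ltW/alt.1.
  have := @spline0_no_knot _ _ 0 a x _ _ sj (fun i => introN idP (kn i)).
  rewrite mul0r addr0 => eqs.
  have := alt.2 j (leqW jr); have := alt.2 j.+1 jr; rewrite eqs exprS; lra.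
have [r0|r0] := posnP r; first by rewrite r0.
have [i0 _] := crossing 0%N r0.
have /choice[f fP] : forall j, exists i, (j < r)%N -> s j < x i <= s j.+1.
  by move=> j; case: (ltnP j r) => [/crossing[i ?]|_]; [exists i|exists i0].
have s_le j l : (j <= l <= r)%N -> s j <= s l.
  case/andP; rewrite leq_eqVlt => /predU1P[->//|jl lr].
  by apply/ltW/(alternating_homo alt); rewrite jl ltnS.
have f_lt j l : (j < l < r)%N -> x (f j) < x (f l).
  move=> /andP[jl lr]; have /andP[_ h] := fP j (ltn_trans jl lr).
  have /andP[h' _] := fP l lr; apply: (le_lt_trans h); apply: le_lt_trans h'.
  by apply: s_le; rewrite jl ltnW.
have finj : injective (fun j : 'I_r => f j).
  move=> j l eqf; apply: val_inj; case: (ltngtP j l) => // jl.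
    by have := @f_lt j l; rewrite jl ltn_ord eqf ltxx => /(_ isT).
  by have := @f_lt l j; rewrite jl ltn_ord eqf ltxx => /(_ isT).
rewrite -[leqLHS]card_ord -(card_imset _ finj).
apply/subset_leq_card/fintype.subsetP => _ /imsetP[j _ ->].
have /andP[h h'] := fP j (ltn_ord j).
rewrite inE (le_lt_trans _ h) ?(le_trans h')//; apply: s_le.
  by rewrite ltn_ord leqnn.
by rewrite leq0n ltnW.
Qed.

(** With nonnegative slope and downward jumps, passing from a positive to a negative value requires
    a knot; such descents occur at every second index. *)
Lemma descent_knots q a x e r s N : 0 <= q -> (forall i, a i <= 0) ->
  alternating (spline q a x 0) e r s -> (N.*2 + (e < 0)%R <= r)%N ->
  exists z : nat -> R,
    [/\ forall j, (j < N)%N -> exists i, z j = x i,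
        forall j, (j.+1 < N)%N -> z j < z j.+1 &
        forall j, (j < N)%N -> exists l, (l.+1 < r)%N /\ s l < z j <= s l.+1].
Proof.
(* [o] is the index of the first positive value, so the descents start at the indices [j.*2 + o]. *)
move=> q0 a0 alt Nr; set o : nat := (e < 0)%R in Nr.
have bound j : (j < N)%N -> ((j.*2 + o).+1 < r)%N by lia.
have crossing j : (j < N)%N -> exists i, s (j.*2 + o)%N < x i <= s (j.*2 + o).+1.
  move=> jN; have jr := bound j jN; apply: contrapT => /forallNP kn.
  have sj : s (j.*2 + o)%N < s (j.*2 + o).+1 by apply/alt.1.
  have := @spline0_no_knot _ _ q a x _ _ (ltW sj) (fun i => introN idP (kn i)).
  have := alt.2 _ (ltnW jr); have := alt.2 _ jr.
  have : 0 <= q * (s (j.*2 + o).+1 - s (j.*2 + o)%N) by rewrite mulr_ge0// subr_ge0 ltW.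
  rewrite exprS -signr_odd oddD odd_double oddb.
  set qs := q * _; set fu := spline _ _ _ _ (s _); set fv := spline _ _ _ _ (s _).
  rewrite /o; have [e0|e0] := ltP e 0; rewrite /= ?expr0 ?expr1; nra.
have [N0|N0] := posnP N.
  by exists (fun=> 0); rewrite N0; split.
have [i0 _] := crossing 0%N N0.
have /choice[f fP] : forall j, exists i, (j < N)%N ->
    s (j.*2 + o)%N < x i <= s (j.*2 + o).+1.
  by move=> j; case: (ltnP j N) => [/crossing[i ?]|_]; [exists i|exists i0].
exists (fun j => x (f j)); split.
- by move=> j _; exists (f j).
- move=> j jN; have /andP[_ h] := fP j (ltnW jN); have /andP[h' _] := fP _ jN.
  apply: (le_lt_trans h); apply: lt_trans h'; apply: (alternating_homo alt).
  by have := bound _ jN; lia.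
- by move=> j jN; exists (j.*2 + o)%N; split; [exact: bound|exact: fP].
Qed.

End SplineKnots.

Lemma increasing_homo (R : realType) (f : nat -> R) m i j :
  (forall i, (i.+1 < m)%N -> f i < f i.+1) -> (i < j < m)%N -> f i < f j.
Proof.
move=> f_incr; elim: j => // j IH /andP[ij jm].
have [->|{}ij] := ltnS_case ij; first exact: f_incr.
by apply: lt_trans (f_incr _ jm); apply: IH; rewrite ij ltnW.
Qed.

(** * Oscillations of the contact function between its zeros *)

Section Contact.
Variables (R : realType) (I : finType) (q : R) (b x : I -> R) (K : nat).
Hypothesis q_gt0 : 0 < q.
Hypothesis b_ge0 : forall i, 0 <= b i.
Hypothesis x_gt0 : forall i, 0 < x i.

Let h := spline q (fun i => - b i) x.
Hypothesis h_ge0 : forall y, 0 < y -> 0 <= h K.+1 y.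

Let h_sign p : sign_derivative (h p.+1) (h p).
Proof. exact: spline_sign_derivative. Qed.

(** Otherwise the nonnegative [h K.+1] would vanish on an interval, against [spline_poly_neq0]. *)
Lemma pos_between (s t : R) : 0 <= s -> s < t -> exists u, s < u < t /\ 0 < h K.+1 u.
Proof.
move=> s0 st; apply: contrapT => /forallNP hN.
have := spline_poly_neq0 (fun i => - b i) x s K.+1 (lt0r_neq0 q_gt0).
rewrite (spline_vanish_itv st) ?eqxx// => y syt; apply/eqP.
have y0 : 0 < y by apply: le_lt_trans s0 _; case/andP: syt.
have := h_ge0 y0; rewrite le_eqVlt eq_sym => /predU1P[|hy]; first by rewrite /h => ->.
by have := hN y; case.
Qed.

Lemma contact_zigzag (y : nat -> R) M :
  (forall j, (j < M)%N -> y j < y j.+1) -> 0 <= y 0%N ->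
  (forall j, (j <= M)%N -> h K.+1 (y j) = 0) ->
  exists s, zigzag (h K.+1) 1 M.*2 s /\
    forall i, (i <= M.*2)%N -> y 0%N <= s i <= y M.
Proof.
move=> y_incr y0 hy.
have y_le j l : (j <= l <= M)%N -> y j <= y l.
  case/andP; rewrite leq_eqVlt => /predU1P[->//|jl lM].
  by apply/ltW/(@increasing_homo _ y M.+1); rewrite ?jl ?ltnS.
have /choice[t tP] : forall j, exists u, (j < M)%N ->
    y j < u < y j.+1 /\ 0 < h K.+1 u.
  move=> j; case: (ltnP j M) => [jM|_]; last by exists 0.
  have yj : 0 <= y j by apply: le_trans y0 (y_le _ _ _); rewrite leq0n ltnW.
  by have [u uP] := pos_between yj (y_incr j jM); exists u.
(* Even indices carry the zeros and odd indices the positive values, so that [M] gaps give [2 M]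
   increments, the first one upwards. *)
exists (fun i => if odd i then t i./2 else y i./2); split; last first.
  move=> i iM; case: ifP => oi.
    have iM' : (i./2 < M)%N by lia.
    have [/andP[h1 h2] _] := tP _ iM'; apply/andP; split.
      by apply: le_trans (ltW h1); apply: y_le; lia.
    by apply: le_trans (ltW h2) _; apply: y_le; lia.
  by apply/andP; split; apply: y_le; lia.
have half_lt i : (i < M.*2)%N -> (i./2 < M)%N by lia.
split=> i /half_lt iM; have [/andP[yt ty] ht] := tP _ iM; rewrite /= uphalf_half.
  by case: (odd i).
rewrite mul1r -signr_odd.
by case: (odd i); rewrite /= ?expr1 ?expr0 ?add0n ?add1n ?(hy _ (ltnW iM)) ?(hy _ iM); lra.
Qed.

(** The point 0 serves as an extra zero, giving [m] gaps and [2 m] increments. As [h] vanishes at 0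
    in every positive order, [2 m] alternating values reach order 0, and each of their [m] descents
    needs a knot, that is, a data point. *)
Lemma contact_left (Y : nat -> R) m :
  (forall j, (j.+1 < m)%N -> Y j < Y j.+1) ->
  (forall j, (j < m)%N -> 0 < Y j /\ h K.+1 (Y j) = 0) ->
  exists z : nat -> R,
    [/\ forall j, (j < m)%N -> exists i, z j = x i,
        forall j, (j.+1 < m)%N -> z j < z j.+1 &
        forall j, (j < m)%N -> 0 < z j < Y m.-1].
Proof.
case: m => [|m] Y_incr YP; first by exists (fun=> 0).
have h0 p : (0 < p)%N -> h p 0 = 0.
  by move=> p0; apply: spline_left_eq0 => //; rewrite ?mulr0// => i; apply/ltW.
have [|||s [zz sP]] := @contact_zigzag (fun j => if j is l.+1 then Y l else 0) m.+1.
- by move=> [|j] jm; [have [] := YP 0%N isT|exact: Y_incr].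
- exact: lexx.
- by move=> [|j] jm; [exact: h0|have [] := YP j jm].
have [s' [alt s'P]] := zigzag_alternating (@h_sign K) zz.
have [||s2 [alt2 s2P]] := @alternating_chain_left _ h h_sign K 1 m.+1.*2 s' 0 (Y m) _ alt.
- by move=> j /andP[j0 _]; exact: h0.
- move=> i im; have /andP[h1 h2] := s'P i im.
  have /andP[h3 _] := sP i (ltnW im); have /andP[_ h4] := sP _ im.
  by rewrite (le_lt_trans h3 h1) (lt_le_trans h2 h4).
have [||z [z1 z2 z3]] := descent_knots (N := m.+1) (ltW q_gt0) _ alt2.
- by move=> i; rewrite oppr_le0.
- by rewrite ltNge ler01 addn0.
exists z; split=> // j jm; have [l [lm /andP[h1 h2]]] := z3 j jm.
have /andP[h3 _] := s2P l (ltnW lm); have /andP[_ h4] := s2P _ lm.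
by rewrite (lt_trans h3 h1) (le_lt_trans h2 h4).
Qed.

(** The [m - 1] gaps give [2 (m - 1)] alternating values at order [K], of which [2 (m - 1) - K]
    reach order 0; these contain at least [m - K - 2] descents, whichever sign comes first. *)
Lemma contact_between (Y : nat -> R) m :
  (forall j, (j.+1 < m)%N -> Y j < Y j.+1) ->
  (forall j, (j < m)%N -> 0 < Y j /\ h K.+1 (Y j) = 0) ->
  exists z : nat -> R,
    [/\ forall j, (j < m - K.+2)%N -> exists i, z j = x i,
        forall j, (j.+1 < m - K.+2)%N -> z j < z j.+1 &
        forall j, (j < m - K.+2)%N -> Y 0%N < z j < Y m.-1].
Proof.
move=> Y_incr YP; set N := (m - K.+2)%N.
have [N0|N0] := posnP N; first by exists (fun=> 0); rewrite N0.
case: m Y_incr YP @N N0 => [|m] Y_incr YP N N0; first by [].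
have [|||s [zz sP]] := @contact_zigzag Y m.
- by move=> j jm; exact: Y_incr.
- by have [/ltW] := YP 0%N isT.
- by move=> j jm; have [] := YP j jm.
have [s' [alt s'P]] := zigzag_alternating (@h_sign K) zz.
have rK : m.*2 = (m.*2 - K + K)%N by rewrite subnK//; lia.
rewrite rK in alt.
have [|s2 [alt2 s2P]] := @alternating_chain _ h h_sign K 1 _ s' (Y 0%N) (Y m) alt.
  rewrite -rK => i im; have /andP[h1 h2] := s'P i im.
  have /andP[h3 _] := sP i (ltnW im); have /andP[_ h4] := sP _ im.
  by rewrite (le_lt_trans h3 h1) (lt_le_trans h2 h4).
have [||z [z1 z2 z3]] := descent_knots (N := N) (ltW q_gt0) _ alt2.
- by move=> i; rewrite oppr_le0.
- by case: (_ < _); lia.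
exists z; split=> // j jm; have [l [lm /andP[h1 h2]]] := z3 j jm.
have /andP[h3 _] := s2P l (ltnW lm); have /andP[_ h4] := s2P _ lm.
by rewrite (lt_trans h3 h1) (le_lt_trans h2 h4).
Qed.

End Contact.

(** * Linear independence at contact points *)

Section Independence.
Variables (R : realType) (I : finType) (q : R) (b x : I -> R) (K : nat).
Hypothesis q_gt0 : 0 < q.
Hypothesis b_ge0 : forall i, 0 <= b i.
Hypothesis x_gt0 : forall i, 0 < x i.
Let h := spline q (fun i => - b i) x.
Hypothesis h_ge0 : forall y, 0 < y -> 0 <= h K.+1 y.

(** In each gap the spline leaves 0 and returns to it, so its derivative takes both signs there;
    [M + 1] gaps give [M + 2] alternating values. *)
Lemma zeros_alternating (J : finType) (c t : J -> R) (w : nat -> R) M :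
  (forall i, (i <= M.+1)%N -> spline 0 c t K.+1 (w i) = 0) ->
  (forall i, (i <= M)%N -> w i < w i.+1) ->
  (forall i, (i <= M)%N -> exists u, w i < u < w i.+1 /\ spline 0 c t K.+1 u != 0) ->
  exists e s, alternating (spline 0 c t K) e M.+2 s /\
    forall i, (i < M.+2)%N -> w 0%N < s i < w M.+1.
Proof.
move=> w0 w_incr nz; set g := spline 0 c t.
have /choice[uv uvP] : forall i, exists uv : R * R, (i <= M)%N ->
    [/\ w i < uv.1, uv.1 < uv.2, uv.2 < w i.+1 & g K uv.1 * g K uv.2 < 0].
  move=> i; case: (leqP i M) => [iM|_]; last by exists (0, 0).
  have [u [/andP[wu uw] gu]] := nz i iM.
  have gu2 : 0 < g K.+1 u ^+ 2 by rewrite exprn_even_gt0.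
  have [|l [/andP[wl lu] gl]] := @spline_sign_derivative _ _ 0 c t K (g K.+1 u) _ _ wu.
    by rewrite (w0 _ (leqW iM)) subr0 -expr2.
  have [|r [/andP[ur rw] gr]] := @spline_sign_derivative _ _ 0 c t K (- g K.+1 u) _ _ uw.
    by rewrite w0// sub0r mulrNN -expr2.
  exists (l, r) => _; split=> //=; first exact: lt_trans ur.
  rewrite -/(g K) in gl gr; rewrite -(pmulr_rlt0 _ gu2) expr2.
  move: gl gr; set G := g K.+1 u; set L := g K l; set T := g K r => gl gr.
  have : 0 < (G * L) * (- G * T) by rewrite mulr_gt0.
  lra.
have w_le j l : (j <= l <= M.+1)%N -> w j <= w l.
  case/andP; rewrite leq_eqVlt => /predU1P[->//|jl lM].
  apply/ltW/(@increasing_homo _ w M.+2); rewrite ?jl ?ltnS//.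
have [||e [s [alt us sv]]] := @alternating_select _ (g K) (fun i => (uv i).1) (fun i => (uv i).2) M.
- by move=> i /uvP[].
- move=> i iM; have [_ _ h1 _] := uvP i (ltnW iM); have [h2 _ _ _] := uvP _ iM.
  exact: lt_trans h2.
exists e, s; split=> // i iM.
have [w0u _ _ _] := uvP 0%N isT; have [_ _ vw _] := uvP M (leqnn _).
have s_le j l : (j <= l < M.+2)%N -> s j <= s l.
  case/andP; rewrite leq_eqVlt => /predU1P[->//|jl lM].
  by apply/ltW/(alternating_homo alt); rewrite jl.
apply/andP; split.
  by apply: (lt_le_trans w0u); apply: (le_trans us); apply: s_le.
by apply: le_lt_trans vw; apply: le_trans sv; apply: s_le; rewrite leqnn -ltnS iM.
Qed.

(** Induction reduces to a nonzero [c 0]. The reflected combination [g] is a spline with knots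
    [- Y j] that vanishes at the [- x i]. If [g] does not vanish beyond its last knot [B], the zeros
    from [contact_left] force as many sign changes at order 0 as there are knots, although the first
    knot [A] cannot be crossed. If it does, the orders 1 to [K + 1] vanish at [B] as well as at [A],
    each Rolle step gains a value, and the fewer zeros from [contact_between] already force more
    sign changes than there are knots strictly between [A] and [B]. *)
Lemma contact_independent m (Y c : nat -> R) :
  (forall j, (j.+1 < m)%N -> Y j < Y j.+1) ->
  (forall j, (j < m)%N -> 0 < Y j /\ h K.+1 (Y j) = 0) ->
  (forall i, \sum_(j < m) c j * tpow K.+1 (Y j - x i) = 0) ->
  forall j, (j < m)%N -> c j = 0.
Proof.
elim/ltn_ind: m Y c => -[//|m] IH Y c Y_incr YP dep.
have [c0|c0] := eqVneq (c 0%N) 0.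
  move=> [//|j] jm; apply: (IH m _ (fun j => Y j.+1) (fun j => c j.+1)) => //.
  - by move=> l lm; exact: Y_incr.
  - by move=> l lm; exact: YP.
  by move=> i; have := dep i; rewrite big_ord_recl c0 mul0r add0r.
exfalso.
have Y_lt j l : (j < l <= m)%N -> Y j < Y l by move=> jl; apply: (@increasing_homo _ Y m.+1).
have Y_le j l : (j <= l <= m)%N -> Y j <= Y l.
  by case/andP; rewrite leq_eqVlt => /predU1P[->//|jl lM]; apply/ltW/Y_lt; rewrite jl.
pose cc (j : 'I_m.+1) := c j; pose tt (j : 'I_m.+1) := - Y j.
pose g := spline 0 cc tt; pose A := - Y m; pose B := - Y 0%N.
have g_sign p : sign_derivative (g p.+1) (g p) by exact: spline_sign_derivative.
have gA p : (0 < p)%N -> g p A = 0.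
  move=> p0; apply: spline_left_eq0 => //; first by rewrite mul0r.
  by move=> j; rewrite lerN2 Y_le// leq_ord leqnn.
have gE y : g K.+1 y = (\sum_(j < m.+1) c j * tpow K.+1 (Y j + y)) / K.+1`!%:R.
  rewrite /g /spline !mul0r add0r mulr_suml; apply: eq_bigr => j _.
  by rewrite /tt opprK addrC.
have gx i : g K.+1 (- x i) = 0 by rewrite gE dep mul0r.
have polyB s : B <= s -> spline_poly 0 cc tt s K.+1 = spline_poly 0 cc tt B K.+1.
  move=> Bs; rewrite /spline_poly; congr (_ + _); apply: eq_bigl => j.
  have tB : tt j <= B by rewrite lerN2 Y_le// leq_ord.
  by rewrite tB (le_trans tB).
(* If the piece starting at some [s] before [B] vanished, the knots beyond [s] alone would satisfy
   the relation at all data points: a shorter relation with the same [c 0], excluded by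
   induction. *)
have poly0 s : A <= s -> s < B -> spline_poly 0 cc tt s K.+1 <> 0.
  move=> As sB P0.
  have ex : exists j, - Y j <= s by exists m.
  (* The knots [- Y j] decrease with [j], so those beyond [s] are exactly those with [j < l]. *)
  have [l Yl l_min] := ex_minnP ex.
  have l0 : (0 < l)%N by rewrite lt0n; apply/eqP => l0; move: Yl; rewrite l0 leNgt sB.
  have lm : (l <= m)%N by apply: l_min.
  have tts (j : 'I_m.+1) : (tt j <= s) = ~~ (j < l)%N.
    rewrite -leqNgt; apply/idP/idP => [/l_min//|lj].
    by apply: le_trans Yl; rewrite lerN2 Y_le// lj leq_ord.
  move/eqP: c0; apply; apply: (IH l _ Y c) => // [j jl|j jl|i].
  - by apply: Y_incr; rewrite ltnS (leq_trans (ltnW jl)).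
  - by apply: YP; rewrite ltnS (leq_trans (ltnW jl)).
  rewrite (big_ord_widen m.+1 (fun j => c j * tpow K.+1 (Y j - x i))) ?leqW//.
  have [sx|xs] := leP s (- x i); last first.
    rewrite big1// => j jl; have := tts j; rewrite jl/= /tt /tpow leNgt => /negbFE h1.
    by rewrite leNgt (_ : Y j - x i < 0) ?mulr0//; lra.
  have := dep i; rewrite (bigID (fun j : 'I_m.+1 => (j < l)%N))/=.
  set S1 := \sum_(_ < _ | _) _; set S2 := \sum_(_ < _ | _) _.
  suff -> : S2 = 0 by rewrite addr0.
  move: P0 => /(congr1 (fun P : {poly R} => P.[- x i])).
  rewrite /spline_poly mul0r scale0r add0r horner0 horner_sum => P0.
  apply/eqP; rewrite -(mulrI_eq0 _ (mulfI (_ : K.+1`!%:R^-1 != 0 :> R))); last first.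
    by rewrite invr_eq0 pnatr_eq0 -lt0n fact_gt0.
  rewrite -P0 /S2 mulr_sumr; apply/eqP/eq_big => [j|j jl]; first by rewrite tts.
  rewrite hornerZ horner_exp hornerXsubC /cc /tt opprK (addrC (- x i)) mulrCA mulrA /tpow.
  rewrite subr_ge0 (_ : x i <= Y j) ?(mulrC (_^-1))//.
  have : tt j <= s by rewrite tts.
  by rewrite /tt; lra.
have nz s t : A <= s -> s < t -> s < B \/ spline_poly 0 cc tt B K.+1 <> 0 ->
    exists u, s < u < t /\ g K.+1 u != 0.
  move=> As st sB; apply: contrapT => /forallNP gN.
  have P0 : spline_poly 0 cc tt s K.+1 = 0.
    apply: (spline_vanish_itv st) => y syt; apply/eqP/negPn/negP => gy.
    by apply: (gN y).
  have [sB'|Bs] := ltP s B; first exact: poly0 P0.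
  case: sB => [|]; first by rewrite ltNge Bs.
  by rewrite -(polyB s).
have [PB|PB] := pselect (spline_poly 0 cc tt B K.+1 = 0); last first.
  have [z [zx z_incr zP]] := contact_left q_gt0 b_ge0 x_gt0 h_ge0 Y_incr YP.
  (* The zeros in increasing order: the knot [A], then the data points, read backwards because of
     the reflection. *)
  pose w i := if i is l.+1 then - z (m - l)%N else A.
  have wA i : (i <= m.+1)%N -> A <= w i.
    case: i => [//|i] im; rewrite /w/= lerN2; apply/ltW.
    by have /andP[] : 0 < z (m - i)%N < Y m by apply: zP; lia.
  have w_incr i : (i <= m)%N -> w i < w i.+1.
    case: i => [|i] im; rewrite /w ltrN2.
      by have /andP[] : 0 < z (m - 0)%N < Y m by apply: zP; lia.
    have := z_incr (m - i.+1)%N; rewrite (_ : (m - i.+1).+1 = m - i)%N; last by lia.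
    by apply; lia.
  have [|||e [s [alt sP]]] := @zeros_alternating _ cc tt w m.
  - case=> [|i] im; first exact: gA.
    have [l zl] : exists l, z (m - i)%N = x l by apply: zx; lia.
    by rewrite /w zl; exact: gx.
  - exact: w_incr.
  - by move=> i im; apply: nz; [apply: wA; rewrite leqW|exact: w_incr|right].
  have [||s2 [alt2 s2P]] := @alternating_chain_left _ g g_sign K e m.+2 s A (w m.+1) _ alt.
  - by move=> j /andP[j0 _]; exact: gA.
  - exact: sP.
  (* The [m + 2] alternating values would need [m + 1] knots beyond [s2 0], but [A] lies before
     it. *)
  have := crossing_count alt2; apply/negP; rewrite -ltnNge.
  rewrite -[ltnRHS](card_ord m.+1) -cardsT; apply/proper_card/properP; split.
    exact: finset.subsetT.
  exists ord_max; rewrite ?inE// negb_and -leNgt; apply/orP; left.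
  by have /andP[/ltW] := s2P 0%N isT.
(* A single truncated power does not vanish beyond its knot. *)
have m0 : (0 < m)%N.
  rewrite lt0n; apply/eqP => m0.
  have Y0 : - Y 0%N < - Y 0%N + 1 by lra.
  have gB y : B <= y -> g K.+1 y = 0.
    move=> By; rewrite /g (@spline_polyE _ _ _ _ _ B)// ?PB ?horner0// => j.
    by rewrite /tt ltrN2 ltNge Y_le// leq_ord.
  have := gB (- Y 0%N + 1); rewrite gE m0 big_ord1 /= addrA subrr add0r /tpow ler01 expr1n mulr1.
  move=> /(_ (ltW Y0)) /eqP; rewrite mulf_eq0 (negbTE c0) invr_eq0 pnatr_eq0.
  by rewrite -leqn0 leqNgt fact_gt0.
have [z [zx z_incr zP]] := contact_between q_gt0 b_ge0 h_ge0 Y_incr YP.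
pose N := (m.+1 - K.+2)%N; rewrite -/N in zx z_incr zP.
have gB p : (0 < p <= K.+1)%N -> g p B = 0.
  move=> /andP[p0 pK]; rewrite /g (@spline_polyE _ _ _ _ _ B)//.
    by rewrite (spline_poly_eq0_le pK PB) horner0.
  by move=> j; rewrite /tt ltrN2 ltNge Y_le// leq_ord.
(* Here [B] is appended as a last zero, which makes [N + 2] zeros in all. *)
pose w i := if i is l.+1 then if (i <= N)%N then - z (N - i)%N else B else A.
have AB : A < B by rewrite ltrN2 Y_lt// m0 leqnn.
have zAB i : (0 < i <= N)%N -> A < - z (N - i)%N < B.
  move=> iN; have /andP[h1 h2] : Y 0%N < z (N - i)%N < Y m by apply: zP; lia.
  by rewrite !ltrN2 h1 h2.
have wA i : A <= w i.
  rewrite /w; case: i => [//|i]; case: ifP => iN; last exact: ltW.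
  by have /andP[/ltW] := @zAB i.+1 iN.
have w_incr i : (i <= N)%N -> w i < w i.+1.
  case: i => [|i] iN; rewrite /w.
    by case: ifP => h1 //; have /andP[] := @zAB 1%N h1.
  rewrite iN; case: ifP => h1; last by have /andP[] := @zAB i.+1 iN.
  rewrite ltrN2; have := z_incr (N - i.+2)%N.
  rewrite (_ : (N - i.+2).+1 = N - i.+1)%N; last by lia.
  by apply; lia.
have wB i : (i <= N)%N -> w i < B.
  by case: i => [//|i] iN; rewrite /w iN; have /andP[] := @zAB i.+1 iN.
have [|||e [s [alt sP]]] := @zeros_alternating _ cc tt w N.
- case=> [|i] im; first exact: gA.
  rewrite /w; case: ifP => h1; last by apply: gB; rewrite leqnn.
  have [l ->] : exists l, z (N - i.+1)%N = x l by apply: zx; lia.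
  exact: gx.
- exact: w_incr.
- by move=> i im; apply: nz; [exact: wA|exact: w_incr|left; exact: wB].
have wN : w N.+1 = B by rewrite /w ltnn.
rewrite wN in sP.
have [|||s2 [alt2 s2P]] := @alternating_chain_both _ g g_sign K e N.+2 s A B _ _ isT alt.
- by move=> j /andP[j0 _]; exact: gA.
- by move=> j /andP[j0 jK]; apply: gB; rewrite j0 leqW.
- exact: sP.
rewrite addSn in alt2 s2P.
have := crossing_count alt2; apply/negP; rewrite -ltnNge.
(* The [N + K + 2] values need [N + K + 1] knots, at least [m], and at most [m - 1] lie strictly
   between [A] and [B]. *)
suff : (#|[set i | (s2 0%N < tt i <= s2 (N.+1 + K)%N)%R]%SET| <= m.-1)%N.
  by move=> /leq_ltn_trans; apply; rewrite /N; lia.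
have -> : m.-1 = #|(~: [set ord0; ord_max])%SET : {set 'I_m.+1}|.
  by rewrite cardsCs finset.setCK card_ord cards2 -val_eqE/= eq_sym -lt0n m0 subn2.
apply/subset_leq_card/fintype.subsetP => j; rewrite !inE => /andP[h1 h2].
have /andP[h3 _] := s2P 0%N isT; have /andP[_ h4] := s2P _ (leqnn _).
rewrite negb_or; apply/andP; split; apply/eqP => jE; rewrite jE /tt/= in h1 h2.
  by move: h2; rewrite leNgt h4.
by move: (lt_trans h3 h1); rewrite ltxx.
Qed.

End Independence.

(** * Interlacing from an invertible minor *)

Section Interlacing.
Variable R : realType.

Lemma underdetermined (m e : nat) (C : 'I_m -> 'I_e -> R) : (e < m)%N ->
  exists v : 'I_m -> R, (exists l, v l != 0) /\
    forall r, \sum_l v l * C l r = 0.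
Proof.
move=> em; pose M := \matrix_(l, r) C l r.
have /negP nfree : ~~ row_free M.
  by rewrite /row_free neq_ltn (leq_ltn_trans (rank_leq_col M) em).
have [u [u0 uM]] : exists u : 'rV_m, u != 0 /\ u *m M = 0.
  apply: contrapT => /forallNP noker; apply: nfree; apply: inj_row_free => u uM.
  by apply/eqP/negPn/negP => u0; apply: (noker u).
exists (u 0); split.
  apply: contrapT => /forallNP u0'; move/eqP: u0; apply; apply/rowP => l.
  by rewrite mxE; apply/eqP/negPn/negP; exact: u0'.
move=> r; have := congr1 (fun A : 'rV_e => A 0 r) uM; rewrite !mxE => uMr.
by rewrite -[RHS]uMr; apply: eq_bigr => l _; rewrite mxE.
Qed.

Variables (n m K : nat) (X : 'I_n -> R) (Y : 'I_m -> R).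
Hypothesis X_nondecr : {homo X : i j / (i <= j)%N >-> i <= j}.
Hypothesis Y_incr : {homo Y : i j / (i < j)%N >-> i < j}.
Hypothesis indep : forall c : 'I_m -> R,
  (forall i, \sum_j c j * tpow K.+1 (Y j - X i) = 0) -> forall j, c j = 0.

(** Independent columns give rank [m], hence [m] rows forming an invertible minor; filtering the
    enumeration of all row indices lists them in increasing order. *)
Lemma independent_minor : exists i : 'I_m -> 'I_n,
  {homo i : j j' / (j < j')%N} /\
  forall v : 'I_m -> R,
    (forall j, \sum_l v l * tpow K.+1 (Y j - X (i l)) = 0) -> forall l, v l = 0.
Proof.
pose A : 'M[R]_(n, m) := \matrix_(i, j) tpow K.+1 (Y j - X i).
have A_full : row_full A.
  rewrite /row_full -mxrank_tr -/(row_free A^T).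
  apply: inj_row_free => u uA; apply/rowP => j; rewrite mxE.
  apply: (indep (c := u 0)) => i.
  have := congr1 (fun B : 'rV_n => B 0 i) uA; rewrite !mxE => uAi.
  by rewrite -[RHS]uAi; apply: eq_bigr => l _; rewrite !mxE.
pose f := fullrankfun A_full.
pose T : {set 'I_n} := [set f j | j : 'I_m].
have cardT : #|T| = m by rewrite card_imset ?card_ord//; exact: fullrankfun_inj.
pose s := [seq i <- enum 'I_n | i \in T].
have size_s : size s = m by rewrite -cardT cardE /s enumT; congr size; apply: eq_filter.
have s_sorted : sorted ltn [seq val i | i <- s].
  apply: (subseq_sorted ltn_trans (map_subseq _ (filter_subseq _ _))).
  by rewrite val_enum_ord iota_ltn_sorted.
pose i (j : 'I_m) := nth (f j) s j.
have iE (j : 'I_m) (y : 'I_n) : i j = nth y s j.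
  by apply: set_nth_default; rewrite size_s.
exists i; split.
  move=> j j' jj'; rewrite !(iE _ (f j)).
  have := sorted_ltn_nth ltn_trans 0%N s_sorted j j'.
  rewrite !inE size_map size_s !ltn_ord => /(_ isT isT jj').
  by rewrite !(nth_map (f j)) ?size_s.
have iA_full : row_full (rowsub i A).
  rewrite -sub1mx; apply: submx_trans (_ : 1%:M <= rowsub f A)%MS _.
    by rewrite sub1mx; exact: fullrowsub_full.
  apply/row_subP => l.
  have fs : f l \in s by rewrite mem_filter mem_enum andbT; apply: imset_f.
  have lt_ix : (index (f l) s < m)%N by have := fs; rewrite -index_mem size_s.
  have -> : row l (rowsub f A) = row (Ordinal lt_ix) (rowsub i A).
    by apply/rowP => j; rewrite !mxE (iE _ (f l)) /= nth_index.
  exact: row_sub.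
have /row_free_inj iA_inj : row_free (rowsub i A) by rewrite row_free_unit -row_full_unit.
move=> v v0 l.
have : \row_l v l = 0.
  apply: (iA_inj 1); rewrite mul0mx; apply/rowP => j; rewrite !mxE -[RHS](v0 j).
  by apply: eq_bigr => l' _; rewrite !mxE.
by move=> /rowP/(_ l); rewrite !mxE.
Qed.

(** Each violated inequality yields a nonzero vector annihilated by the minor. A tie gives two equal
    rows; in the other cases a solution of [m - 1] linear conditions on [m] unknowns satisfies all
    [m] equations. *)
Lemma interlacing : exists i : 'I_m -> 'I_n,
  [/\ {homo i : j j' / (j < j')%N},
      {homo (fun j => X (i j)) : j j' / (j < j')%N >-> j < j'} &
      forall j : 'I_m, X (i j) < Y j /\
        forall l : 'I_m, (l = j + K.+2 :> nat)%N -> Y j < X (i l)].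
Proof.
have [i [i_incr minor]] := independent_minor.
have Xi_le (l l' : 'I_m) : (l <= l')%N -> X (i l) <= X (i l').
  rewrite leq_eqVlt => /predU1P[/val_inj->//|/i_incr/ltnW]; exact: X_nondecr.
have Y_le (l l' : 'I_m) : (l <= l')%N -> Y l <= Y l'.
  by rewrite leq_eqVlt => /predU1P[/val_inj->//|/Y_incr/ltW].
have minorN (v : 'I_m -> R) : (exists l, v l != 0) ->
    ~ forall j, \sum_l v l * tpow K.+1 (Y j - X (i l)) = 0.
  by move=> [l vl] /minor/(_ l) vl0; rewrite vl0 eqxx in vl.
exists i; split=> //.
  move=> j j' jj'; rewrite lt_neqAle Xi_le ?(ltnW jj')// andbT; apply/eqP => Xjj'.
  have jj : (j == j') = false by apply/eqP => e; rewrite e ltnn in jj'.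
  apply: (@minorN (fun l => (l == j)%:R - (l == j')%:R)).
    by exists j; rewrite eqxx jj subr0 oner_neq0.
  move=> r; under eq_bigr do rewrite mulrBl.
  have pick1 l0 : \sum_(l < m) (l == l0)%:R * tpow K.+1 (Y r - X (i l)) =
      tpow K.+1 (Y r - X (i l0)).
    rewrite (bigD1 l0)//= eqxx mul1r big1 ?addr0// => l /negbTE->.
    by rewrite mul0r.
  by rewrite big_split/= sumrN !pick1 Xjj' subrr.
move=> j; split.
  rewrite ltNge; apply/negP => Yj.
  have em : (m.-1 < m)%N by rewrite ltn_predL (leq_trans _ (ltn_ord j)).
  (* The conditions are [v l = 0] for [l < j] and the equations of [Y r] for [r > j]. The equations
     with [r <= j] then hold because [Y r <= X (i l)] for every [l >= j]. *)
  pose C (l : 'I_m) (r : 'I_m.-1) : R := if (r < j)%N then (val l == val r)%:R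
    else tpow K.+1 (Y (lift j r) - X (i l)).
  have [v [v0 vC]] := underdetermined C em.
  apply: (minorN v v0) => r.
  have [rj|jr] := leqP r j.
    apply: big1 => l _; have [lj|jl] := ltnP l j.
      have lm : (l < m.-1)%N by apply: leq_trans lj _; rewrite -ltnS prednK// (leq_trans _ (ltn_ord j)).
      have := vC (Ordinal lm); rewrite /C/= lj (bigD1 l)//= eqxx mulr1 big1 ?addr0.
        by move=> ->; rewrite mul0r.
      by move=> l'; rewrite -val_eqE => /negbTE->; rewrite mulr0.
    rewrite tpow_max// max_r ?expr0n ?mulr0// subr_le0.
    exact: le_trans (Y_le _ _ rj) (le_trans Yj (Xi_le _ _ jl)).
  case: (unliftP j r) => [r' rE|rj]; last by rewrite rj ltnn in jr.
  have r'j : (r' < j)%N = false.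
    by move: jr; rewrite rE /= /bump; lia.
  by have := vC r'; rewrite /C r'j -rE.
move=> l lE; rewrite ltNge; apply/negP => XY.
have em : (m.-1 < m)%N by rewrite ltn_predL (leq_trans _ (ltn_ord j)).
have jm (r : nat) : (r < j)%N -> (r < m)%N by move=> h; exact: ltn_trans h (ltn_ord j).
(* Three groups of conditions: the equations of [Y r] for [r < j], the moments of [v] of degree at
   most [K + 1] at the points [- X (i l')], and [v l' = 0] for [l' > l]. For [r >= j] the truncation
   is inactive on the remaining points, and the binomial expansion reduces the equation to the
   moments. *)
pose C (l' : 'I_m) (r : 'I_m.-1) : R :=
  if (r < j)%N then tpow K.+1 (Y (insubd j (val r)) - X (i l'))
  else if (r < l)%N then (- X (i l')) ^+ (r - j) else (val l' == r.+1)%:R.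
have [v [v0 vC]] := underdetermined C em.
have lm : (l <= m.-1)%N by rewrite -ltnS prednK// (leq_trans _ (ltn_ord j)).
have v_eq0 (l' : 'I_m) : (l < l')%N -> v l' = 0.
  move=> ll'; have l'0 : (0 < l')%N by apply: leq_ltn_trans ll'.
  have l'm : (l'.-1 < m.-1)%N by have := ltn_ord l'; lia.
  have := vC (Ordinal l'm); rewrite /C/=.
  have -> : (l'.-1 < j)%N = false by lia.
  have -> : (l'.-1 < l)%N = false by lia.
  rewrite prednK// (bigD1 l')//= eqxx mulr1 big1 ?addr0// => l2.
  by rewrite -val_eqE => /negbTE->; rewrite mulr0.
have v_pow e : (e < K.+2)%N -> \sum_l' v l' * (- X (i l')) ^+ e = 0.
  move=> eK; have r_lt : (j + e < m.-1)%N by lia.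
  have := vC (Ordinal r_lt); rewrite /C/=.
  have -> : (j + e < j)%N = false by lia.
  have -> : (j + e < l)%N by lia.
  by rewrite addKn.
apply: (minorN v v0) => r.
have [rj|jr] := ltnP r j.
  have r_lt : (r < m.-1)%N by lia.
  have := vC (Ordinal r_lt); rewrite /C/= rj.
  by rewrite (_ : insubd j (val r) = r)//; apply: val_inj; rewrite val_insubd ltn_ord.
rewrite (eq_bigr (fun l' => v l' * (Y r - X (i l')) ^+ K.+1)) => [|l' _].
  under eq_bigr => l' _ do rewrite exprDn mulr_sumr.
  rewrite exchange_big/= big1// => e _.
  transitivity ((\sum_l' v l' * (- X (i l')) ^+ e) * (Y r ^+ (K.+1 - e) *+ 'C(K.+1, e))).
    by rewrite mulr_suml; apply: eq_bigr => l' _; rewrite -mulrA; congr (_ * _); rewrite -mulrnAl mulrC.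
  by rewrite v_pow ?mul0r.
have [/v_eq0->|l'l] := ltnP l l'; first by rewrite !mul0r.
rewrite /tpow subr_ge0 ifT//.
exact: le_trans (Xi_le _ _ l'l) (le_trans XY (Y_le _ _ jr)).
Qed.

End Interlacing.

(** * The finite-dimensional optimisation problem *)

Section Optimizer.
Variable R : realType.

Lemma continuous_sum (T : topologicalType) (J : Type) (s : seq J) (F : J -> T -> R) :
  (forall j, continuous (F j)) -> continuous (fun t => \sum_(j <- s) F j t).
Proof.
move=> Fc t; elim: s => [|j s IH].
  by under eq_fun do rewrite big_nil; exact: cvg_cst.
by under eq_fun do rewrite big_cons; apply: cvgD => //; exact: Fc.
Qed.

Lemma continuous_prod (T : topologicalType) (J : Type) (s : seq J) (F : J -> T -> R) :
  (forall j, continuous (F j)) -> continuous (fun t => \prod_(j <- s) F j t).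
Proof.
move=> Fc t; elim: s => [|j s IH].
  by under eq_fun do rewrite big_nil; exact: cvg_cst.
by under eq_fun do rewrite big_cons; apply: cvgM => //; exact: Fc.
Qed.

Lemma prod_first_order (J : Type) (s : seq J) (d : J -> R) :
  exists C, 0 <= C /\ forall t, 0 <= t <= 1 ->
    `|\prod_(j <- s) (1 + t * d j) - (1 + t * \sum_(j <- s) d j)| <= C * t ^+ 2.
Proof.
elim: s => [|j s [C [C0 IH]]].
  by exists 0; split=> // t _; rewrite !big_nil mulr0 addr0 subrr normr0 mul0r.
set S := \sum_(j <- s) d j in IH *.
exists (C + `|d j| * (`|S| + C)); split; first by rewrite addr_ge0// mulr_ge0// addr_ge0.
move=> t /[dup] t01 /andP[t0 t1]; rewrite !big_cons -/S.
have := IH t t01; set P := \prod_(j <- s) _ => PC.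
have -> : (1 + t * d j) * P - (1 + t * (d j + S)) =
    (P - (1 + t * S)) + t * d j * (P - (1 + t * S)) + t * d j * (t * S) by ring.
have tt : t ^+ 2 * t <= t ^+ 2 by rewrite ler_piMr// sqr_ge0.
have h1 : `|t * d j * (P - (1 + t * S))| <= `|d j| * C * t ^+ 2.
  rewrite 2!normrM (ger0_norm t0) (mulrC t) -!mulrA ler_wpM2l//.
  apply: le_trans (_ : t * (C * t ^+ 2) <= _); first by rewrite ler_wpM2l.
  by rewrite mulrCA ler_wpM2l// mulrC.
have h2 : `|t * d j * (t * S)| <= `|d j| * `|S| * t ^+ 2.
  by rewrite !normrM (ger0_norm t0) expr2; lra.
apply: (le_trans (ler_normD _ _)); apply: (le_trans (lerD (ler_normD _ _) (lexx _))).
lra.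
Qed.

Lemma prod_le1_slope (J : finType) (d : J -> R) :
  (forall t, 0 <= t <= 1 -> \prod_j (1 + t * d j) <= 1) -> \sum_j d j <= 0.
Proof.
move=> P1; rewrite leNgt; apply/negP => S0; set S := \sum_j d j in S0.
have [C [C0 PC]] := prod_first_order (index_enum J) d.
(* This [t] satisfies [S - C * t = S * t], so the lower bound [1 + t * S - C * t ^+ 2] exceeds 1. *)
pose t := S / (S + C).
have SC : 0 < S + C by rewrite ltr_wpDr.
have t0 : 0 < t by rewrite divr_gt0.
have t01 : 0 <= t <= 1 by rewrite ltW//= ler_pdivrMr// mul1r lerDl.
have tSC : t * (S + C) = S by rewrite divfK ?gt_eqF.
move: t t0 t01 tSC => t t0 t01 tSC.
have := PC t t01; have := P1 t t01; rewrite -/S.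
set P := \prod_j _ => Ple1; rewrite ler_norml => /andP[h _].
have : 0 < t * (S - C * t) by rewrite mulr_gt0// (_ : S - C * t = S * t) ?mulr_gt0//; lra.
by rewrite expr2 in h; lra.
Qed.

Variables (n : nat) (f : 'I_n -> R -> R) (U : R).
Hypothesis f_cont : forall i, continuous (f i).
Hypothesis f_ge0 : forall i u, 0 <= u <= U -> 0 <= f i u.

Let mix (w u : 'I_n.+1 -> R) (i : 'I_n) : R := \sum_j w j * f i (u j).
(** A total weight below 1 is allowed: removing a linear dependency in [free_slot] may lower the
    total, and [optimizer_kkt] recovers the value 1. *)
Let feasible (w u : 'I_n.+1 -> R) :=
  [/\ forall j, 0 <= w j, \sum_j w j <= 1 & forall j, 0 <= u j <= U].

Lemma optimizer_exists u0 : 0 <= u0 <= U ->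
  exists w u, feasible w u /\
    forall w' u', feasible w' u' -> \prod_i mix w' u' i <= \prod_i mix w u i.
Proof.
move=> u0U; pose N := n.+1.
pose A := [set w : 'rV[R]_N | forall j, `[0%R, 1%R]%classic (w ord0 j)] `&`
  [set w : 'rV[R]_N | \sum_j w ord0 j <= 1].
pose B := [set u : 'rV[R]_N | forall j, `[0%R, U]%classic (u ord0 j)].
have coordc (m : nat) (j : 'I_m) : continuous (fun w : 'rV[R]_m => w ord0 j).
  exact: coord_continuous.
have cA : compact A.
  apply: compact_closedI.
    by apply: (@rV_compact R N (fun=> `[0%R, 1%R]%classic)) => j; exact: segment_compact.
  apply: (@preimage_closed _ _ (fun w : 'rV[R]_N => \sum_j w ord0 j) [set x | x <= 1]).
    by move=> w _; apply: continuous_sum => j; exact: coordc.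
  exact: closed_le.
have cB : compact B.
  by apply: (@rV_compact R N (fun=> `[0%R, U]%classic)) => j; exact: segment_compact.
pose Phi (wu : 'rV[R]_N * 'rV[R]_N) := \prod_i \sum_j wu.1 ord0 j * f i (wu.2 ord0 j).
have Phic : continuous Phi.
  apply: continuous_prod => i; apply: continuous_sum => j wu.
  apply: cvgM.
    by apply: (@continuous_comp _ _ _ fst (fun w : 'rV[R]_N => w ord0 j));
      [exact: cvg_fst|exact: coordc].
  apply: (@continuous_comp _ _ _ (fun wu : 'rV[R]_N * 'rV[R]_N => wu.2 ord0 j) (f i)).
    by apply: (@continuous_comp _ _ _ snd (fun w : 'rV[R]_N => w ord0 j));
      [exact: cvg_snd|exact: coordc].
  exact: f_cont.
have AB0 : (A `*` B) !=set0.
  exists (0, const_mx u0); split=> /=.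
    split=> [j|] /=; first by rewrite mxE in_itv/= lexx ler01.
    by rewrite big1 ?ler01// => j _; rewrite mxE.
  by move=> j; rewrite mxE.
have [[w u] /set_mem[/= [wA1 wA2] uB] wu_max] :=
  compact_EVT_max AB0 (compact_setX cA cB) (continuous_subspaceT Phic).
exists (w ord0), (u ord0); split.
  split=> //; first by move=> j; have := wA1 j; rewrite /= in_itv/= => /andP[].
move=> w' u' [w'0 w'1 u'U].
have := wu_max (\row_j w' j, \row_j u' j); rewrite /Phi/=.
under eq_bigr do under eq_bigr do rewrite !mxE.
apply; apply/mem_set; split=> /=; last first.
  by move=> j; rewrite mxE/= in_itv/=; exact: u'U.
split=> [j|] /=; last by under eq_bigr do rewrite mxE.
rewrite mxE in_itv/= w'0/=; apply: le_trans w'1.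
by rewrite (bigD1 j)//= lerDl sumr_ge0.
Qed.

(* [n + 1] vectors of [R^n] are dependent, so the maximiser can be chosen with a
   null weight, which leaves an atom free for perturbations. *)
Lemma free_slot w u : feasible w u -> exists w', [/\ feasible w' u,
  forall i, mix w' u i = mix w u i & exists j, w' j = 0].
Proof.
move=> [w0 w1 uU].
have [c [[l cl] cC]] := underdetermined (fun (j : 'I_n.+1) i => f i (u j)) (ltnSn n).
(* With this sign of the dependency, subtracting a nonnegative multiple of it does not raise the
   total weight. *)
wlog S0 : c cl cC / 0 <= \sum_j c j => [hw|].
  have [S0|S0] := leP 0 (\sum_j c j); first exact: hw S0.
  apply: (hw (fun j => - c j)); first by rewrite oppr_eq0.
    by move=> i; under eq_bigr do rewrite mulNr; rewrite sumrN cC oppr0.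
  by rewrite sumrN oppr_ge0 ltW.
have [j0 cj0] : exists j, 0 < c j.
  apply: contrapT => /forallNP cN.
  have cle0 j : 0 <= - c j by rewrite oppr_ge0 leNgt; apply/negP/cN.
  have : \sum_j - c j = 0.
    by apply/le_anti; rewrite sumr_ge0 ?andbT// sumrN oppr_le0.
  move/eqP; rewrite psumr_eq0// => /allP/(_ l (mem_index_enum l)).
  by rewrite /= oppr_eq0 (negbTE cl).
(* The smallest ratio [w j / c j] is the multiple at which the first weight reaches 0. *)
have [j1 cj1 j1_min] :=
  @arg_minP _ _ _ j0 (fun j => 0 < c j) (fun j => w j / c j) cj0.
pose t := w j1 / c j1.
have t0 : 0 <= t by rewrite divr_ge0// ltW.
exists (fun j => w j - t * c j); split.
- split=> // [j|].
    rewrite subr_ge0; have [cj|cj] := ltP 0 (c j); last first.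
      by apply: le_trans (w0 j); rewrite mulr_ge0_le0.
    by rewrite -ler_pdivlMr// j1_min.
  by rewrite sumrB -mulr_sumr; apply: le_trans w1; rewrite lerBlDr lerDl mulr_ge0.
- move=> i; rewrite /mix; under eq_bigr do rewrite mulrBl -mulrA.
  by rewrite sumrB -mulr_sumr cC mulr0 subr0.
- by exists j1; rewrite /t divfK ?subrr// gt_eqF.
Qed.

(** Mass [t] is put at an arbitrary [v] through the free atom, the other weights being scaled by
    [1 - t]; maximality and [prod_le1_slope] give the inequality. Equality at the atoms is
    complementary slackness. *)
Lemma optimizer_kkt u0 : (0 < n)%N -> 0 <= u0 <= U -> (forall i, 0 < f i u0) ->
  exists w u : 'I_n.+1 -> R, exists p : 'I_n -> R,
    [/\ [/\ forall j, 0 <= w j, \sum_j w j = 1 & forall j, 0 <= u j <= U],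
        forall i, 0 < p i, forall i, p i = \sum_j w j * f i (u j),
        forall v, 0 <= v <= U -> \sum_i f i v / p i <= n%:R &
        forall j, 0 < w j -> \sum_i f i (u j) / p i = n%:R].
Proof.
move=> n0 u0U fu0.
have [w1 [u [feas1 max1]]] := optimizer_exists u0U.
have [w [feas mixE [j0 wj0]]] := free_slot feas1.
have max w' u' : feasible w' u' -> \prod_i mix w' u' i <= \prod_i mix w u i.
  by move=> /max1 h; rewrite (eq_bigr _ (fun i _ => mixE i)).
have {w1 feas1 max1 mixE} [w0 w1 uU] := feas.
set p := mix w u in max.
have p_ge0 i : 0 <= p i by apply: sumr_ge0 => j _; rewrite mulr_ge0// f_ge0.
have P0 : 0 < \prod_i p i.
  apply: lt_le_trans (_ : \prod_i f i u0 <= _); first exact: prodr_gt0.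
  have /max : feasible (fun j => (j == ord0)%:R) (fun=> u0).
    split=> //; rewrite (bigD1 ord0)//= big1 ?addr0//.
    by move=> j /negbTE->.
  rewrite (eq_bigr (fun i => f i u0))// => i _.
  rewrite /mix (bigD1 ord0)//= mul1r big1 ?addr0//.
  by move=> j /negbTE->; rewrite mul0r.
have p_gt0 i : 0 < p i.
  rewrite lt_neqAle p_ge0 andbT eq_sym; apply/eqP => pi0.
  by move: P0; rewrite (bigD1 i)//= pi0 mul0r ltxx.
have slope v : 0 <= v <= U -> \sum_i f i v / p i <= n%:R.
  move=> vU; have : \sum_i (f i v / p i - 1) <= 0.
    apply: prod_le1_slope => t /andP[t0 t1].
    have /max : feasible (fun j => if j == j0 then t else (1 - t) * w j)
        (fun j => if j == j0 then v else u j).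
      split=> [j||j]; [|
        |by case: ifP].
      - by case: ifP => // _; rewrite mulr_ge0// subr_ge0.
      rewrite (bigD1 j0)//= eqxx.
      under eq_bigr => j /negbTE jj0 do rewrite jj0.
      rewrite -mulr_sumr; move: w1; rewrite (bigD1 j0)//= wj0 add0r => w1.
      have : (1 - t) * (1 - \sum_(j < n.+1 | j != j0) w j) >= 0.
        by rewrite mulr_ge0// subr_ge0.
      lra.
    rewrite (eq_bigr (fun i => p i * (1 + t * (f i v / p i - 1)))) => [|i _].
      by rewrite big_split/= ger_pMr.
    rewrite /mix (bigD1 j0)//= eqxx.
    under eq_bigr => j /negbTE jj0 do rewrite jj0 -mulrA.
    have -> : p i = \sum_(j < n.+1 | j != j0) w j * f i (u j).
      by rewrite /p /mix (bigD1 j0)//= wj0 mul0r add0r.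
    have := p_gt0 i; rewrite {1}/p /mix (bigD1 j0)//= wj0 mul0r add0r.
    set S := \sum_(j < n.+1 | _) _ => S0; rewrite -mulr_sumr -/S; field.
    by rewrite gt_eqF.
  by rewrite sumrB sumr_const card_ord subr_le0.
(* The left side is nonnegative by the slope inequality and the right side nonpositive; both are
   therefore 0, which gives total weight 1 and equality at each atom of positive weight. *)
have wD : \sum_j w j * (n%:R - \sum_i f i (u j) / p i) = (\sum_j w j - 1) * n%:R.
  under eq_bigr do rewrite mulrBr mulr_sumr.
  rewrite sumrB -mulr_suml exchange_big/= mulrBl mul1r; congr (_ - _).
  rewrite (eq_bigr (fun=> 1)) ?sumr_const ?card_ord// => i _.
  under eq_bigr do rewrite mulrA.
  by rewrite -mulr_suml -/(mix w u i) -/(p i) divff// lt0r_neq0.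
have wD_ge0 j : 0 <= w j * (n%:R - \sum_i f i (u j) / p i).
  by rewrite mulr_ge0// subr_ge0 slope.
have wD_le0 : (\sum_j w j - 1) * n%:R <= 0 by rewrite mulr_le0_ge0// subr_le0.
have wD0 : \sum_j w j * (n%:R - \sum_i f i (u j) / p i) = 0.
  by apply/le_anti; rewrite sumr_ge0// andbT wD.
exists w, u, p; split=> //.
- split=> //; move: wD0; rewrite wD => /eqP.
  by rewrite mulf_eq0 pnatr_eq0 (gtn_eqF n0) orbF subr_eq0 => /eqP.
- move=> j wj; move/eqP: wD0; rewrite psumr_eq0// => /allP/(_ j (mem_index_enum j))/=.
  by rewrite mulf_eq0 (gt_eqF wj)/= subr_eq0 => /eqP.
Qed.

End Optimizer.

(** * Mixtures and their mixing measures *)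

Section Kernel.
Variable R : realType.
Implicit Types (x y : R) (k : nat).

Definition kern k x y : R := y^-1 * g0 k (x / y).

Lemma kern_ge0 k x y : 0 <= y -> 0 <= kern k x y.
Proof.
by move=> y0; rewrite mulr_ge0 ?invr_ge0// mulr_ge0// exprn_ge0// le_max lexx orbT.
Qed.

Lemma kernE K x y : 0 < y ->
  kern K.+2 x y = K.+2%:R * tpow K.+1 (y - x) / y ^+ K.+2.
Proof.
move=> y0; have yN : y != 0 by rewrite gt_eqF.
have -> : tpow K.+1 (y - x) = (y * Num.max (1 - x / y) 0) ^+ K.+1.
  rewrite tpow_max// maxr_pMr ?(ltW y0)// mulr0 mulrBr mulr1 mulrCA divff// mulr1.
  by [].
rewrite /kern /g0 succnK (exprS y K.+1) exprMn.
have := expf_neq0 K.+1 yN; move: (y ^+ K.+1) (Num.max _ _ ^+ K.+1) => a b aN.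
by field; rewrite yN aN.
Qed.

Lemma kern_gt0 K x y : 0 < y -> (0 < kern K.+2 x y) = (x < y).
Proof.
move=> y0; rewrite kernE// pmulr_lgt0 ?invr_gt0 ?exprn_gt0// pmulr_rgt0 ?ltr0n//.
rewrite tpow_max//; case: (leP (y - x) 0); rewrite ?subr_le0 => yx.
  by rewrite expr0n ltxx ltNge yx.
by rewrite exprn_gt0// -subr_gt0 yx.
Qed.

Lemma continuous_kern_inv k x : continuous (fun u : R => u * g0 k (x * u)).
Proof.
move=> u; apply: cvgM; first exact: cvg_id.
apply: cvgM; first exact: cvg_cst.
apply: (@continuous_comp _ _ _ (fun u : R => Num.max (1 - x * u) 0) (fun v : R => v ^+ k.-1));
  last exact: exprn_continuous.
apply: (@continuous_max _ _ (fun u : R => 1 - x * u) (fun=> 0)); last exact: cvg_cst.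
apply: cvgB; first exact: cvg_cst.
by apply: cvgM; [exact: cvg_cst|exact: cvg_id].
Qed.

Lemma measurable_kern k x :
  measurable_fun (`]0%R, +oo[%classic : set (measurableTypeR R)) (kern k x).
Proof.
apply: open_continuous_measurable_fun; first exact: interval_open.
move=> y; rewrite inE/= in_itv/= andbT => y0.
apply: (@continuous_comp _ _ _ (@GRing.inv R) (fun u : R => u * g0 k (x * u))).
  by apply: inv_continuous; rewrite gt_eqF.
exact: continuous_kern_inv.
Qed.

End Kernel.

(** The ratios [m i / p i] have mean at most 1, hence product at most 1; equality in the
    arithmetic-geometric mean inequality makes them all equal to their mean, which is then 1. *)
Lemma agm_ratio (R : realType) (n : nat) (m p : 'I_n -> R) : (0 < n)%N ->
  (forall i, 0 <= m i) -> (forall i, 0 < p i) -> \sum_i m i / p i <= n%:R ->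
  \prod_i m i <= \prod_i p i /\
  (\prod_i p i <= \prod_i m i -> forall i, m i = p i).
Proof.
move=> n0 m0 p0 mp.
have nR : 0 < n%:R :> R by rewrite ltr0n.
have r0 i : 0 <= m i / p i by rewrite divr_ge0// ltW.
have := leif_AGM (A := predT) (E := fun i => m i / p i) (in1W r0).
rewrite card_ord; set mu := (\sum_(i in _) _) / _ => agm.
have mu_le1 : mu <= 1 by rewrite /mu ler_pdivrMr// mul1r.
have mu0 : 0 <= mu by rewrite divr_ge0// sumr_ge0.
have PP0 : 0 < \prod_i p i by apply: prodr_gt0.
have prodE : \prod_(i in predT) (m i / p i) = \prod_i m i / \prod_i p i.
  by rewrite big_split/= prodfV.
rewrite prodE in agm.
have ratio_le1 : \prod_i m i / \prod_i p i <= 1.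
  by apply: (le_trans agm.1); rewrite exprn_ile1.
split; first by move: ratio_le1; rewrite ler_pdivrMr// mul1r.
move=> pm.
have ratio1 : \prod_i m i / \prod_i p i = 1.
  by apply/le_anti; rewrite ratio_le1 ler_pdivlMr// mul1r pm.
have mu1 : mu = 1.
  apply/eqP; rewrite eq_le mu_le1/= leNgt; apply/negP => mu_lt1.
  have := agm.1; rewrite ratio1 leNgt exprn_ilt1 ?lt0n_neq0//.
have /esym := agm.2; rewrite ratio1 mu1 expr1n eqxx => /forall_inP eqr i.
have eqi j : m j / p j = m i / p i.
  by have /forall_inP/(_ i isT)/eqP := eqr j isT.
have : m i / p i = 1.
  rewrite -mu1 /mu (eq_bigr (fun=> m i / p i)) => [|j _]; last exact: eqi.
  by rewrite sumr_const card_ord -[X in X / _]mulr_natr mulfK// gt_eqF.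
by move/divr1_eq.
Qed.

(** * Integrals of the directional derivative against mixing measures *)

Section MixtureIntegrals.
Variable R : realType.
Implicit Types (G : probability (measurableTypeR R) R).

Notation pos := (`]0%R, +oo[%classic : set (measurableTypeR R)).

Lemma measurable_pos : measurable pos.
Proof. exact: measurable_itv. Qed.

Lemma posE (y : R) : pos y <-> 0 < y.
Proof. by rewrite /= in_itv/= andbT. Qed.

Lemma mixtureE k G (x : R) : 0 <= x ->
  mixture k G x = (\int[G]_(y in pos) (kern k x y)%:E)%E.
Proof. by move=> x0; rewrite /mixture x0. Qed.

Lemma eq_mixture k G G' : (forall A, measurable A -> G A = G' A) ->
  mixture k G = mixture k G'.
Proof.
move=> GG'; apply/funext => x; rewrite /mixture; case: ifP => // _.
by apply: eq_measure_integral => A mA _; exact: GG'.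
Qed.

Variables (k n : nat) (x p : 'I_n -> R).
Hypothesis x_gt0 : forall i, 0 < x i.
Hypothesis p_gt0 : forall i, 0 < p i.

(* [contactD y - n] is the directional derivative of the log-likelihood at the
   values [p], towards the kernel with parameter [y]. *)
Definition contactD (y : R) : R := \sum_i kern k (x i) y / p i.

Hypothesis contactD_le : forall y, 0 < y -> contactD y <= n%:R.

Lemma contactD_ge0 y : 0 < y -> 0 <= contactD y.
Proof.
by move=> y0; apply: sumr_ge0 => i _; rewrite divr_ge0 ?(ltW (p_gt0 i))// kern_ge0// ltW.
Qed.

Lemma measurable_contactD : measurable_fun pos contactD.
Proof.
apply: measurable_sum => i; apply: measurable_funM => //.
exact: measurable_kern.
Qed.

(** The integral of [contactD] is at most [n] and is a combination, with positive coefficients, of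
    the values of the mixture; these are therefore finite. *)
Lemma mixture_values G : mixing G -> exists m : 'I_n -> R,
  [/\ forall i, mixture k G (x i) = (m i)%:E, forall i, 0 <= m i,
      \sum_i m i / p i <= n%:R &
      (\int[G]_(y in pos) (contactD y)%:E)%E = (\sum_i m i / p i)%:E].
Proof.
move=> mixG.
have intD : (\int[G]_(y in pos) (contactD y)%:E)%E =
    (\sum_i (p i)^-1%:E * mixture k G (x i))%E.
  under eq_integral do rewrite /contactD -sumEFin.
  rewrite ge0_integral_sum//=.
  - apply: eq_bigr => i _; rewrite mixtureE ?ltW// -ge0_integralZl//=.
    + by apply: eq_integral => y _; rewrite -EFinM mulrC.
    + by apply/measurable_EFinP; exact: measurable_kern.
    + by move=> y /posE/ltW y0; rewrite lee_fin kern_ge0.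
    + by rewrite lee_fin invr_ge0 ltW.
  - move=> i; apply/measurable_EFinP; apply: measurable_funM => //.
    exact: measurable_kern.
  - move=> i y /posE/ltW y0.
    by rewrite lee_fin divr_ge0 ?kern_ge0// ltW.
have intD_le : (\int[G]_(y in pos) (contactD y)%:E <= n%:R%:E)%E.
  have -> : n%:R%:E = (\int[G]_(y in pos) (cst n%:R%:E) y)%E.
    rewrite integral_cst//.
    by rewrite [X in (_ * X)%E](_ : _ = 1%E) ?mule1.
  apply: ge0_le_integral => //.
  - by move=> y /posE y0; rewrite lee_fin contactD_ge0.
  - by apply/measurable_EFinP; exact: measurable_contactD.
  - by move=> y /posE y0; rewrite lee_fin contactD_le.
have mix_ge0 i : (0 <= mixture k G (x i))%E.
  rewrite mixtureE ?(ltW (x_gt0 i))//; apply: integral_ge0 => y /posE/ltW y0.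
  by rewrite lee_fin kern_ge0.
have term_ge0 i : (0 <= (p i)^-1%:E * mixture k G (x i))%E.
  by rewrite mule_ge0// lee_fin invr_ge0 ltW.
have mix_fin i : mixture k G (x i) \is a fin_num.
  rewrite ge0_fin_numE// ltNge leye_eq; apply/negP => /eqP mixy.
  move: intD_le; rewrite intD (bigD1 i)//= mixy gt0_muley ?lte_fin ?invr_gt0//.
  by rewrite addye// gt_eqF// (lt_le_trans (ltNy0))// sume_ge0.
exists (fun i => fine (mixture k G (x i))); split.
- by move=> i; rewrite fineK.
- by move=> i; rewrite fine_ge0.
- rewrite -lee_fin -sumEFin; apply: le_trans intD_le; rewrite intD.
  by apply: lee_sum => i _; rewrite EFinM fineK// muleC.
- by rewrite intD -sumEFin; apply: eq_bigr => i _; rewrite EFinM fineK// muleC.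
Qed.

(** The nonnegative function [n - contactD] has integral [n - n = 0], so it vanishes almost
    everywhere. *)
Lemma contact_mass G (F : set R) : mixing G ->
  (forall i, mixture k G (x i) = (p i)%:E) ->
  measurable (F : set (measurableTypeR R)) ->
  (forall y, 0 < y -> contactD y = n%:R -> F y) -> G (~` F) = 0%E.
Proof.
move=> mixG mixp mF contactF.
have [m [mE m0 m_le intD]] := mixture_values mixG.
have intDn : (\int[G]_(y in pos) (contactD y)%:E)%E = n%:R%:E.
  rewrite intD; congr EFin; rewrite (eq_bigr (fun=> 1)) ?sumr_const ?card_ord// => i _.
  have [->] : (m i)%:E = (p i)%:E by rewrite -mE mixp.
  by rewrite divff// gt_eqF.
have mfg : measurable_fun pos (fun y => (n%:R - contactD y)%:E).
  apply/measurable_EFinP; apply: measurable_funB => //.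
  exact: measurable_contactD.
have g_ge0 y : pos y -> (0 <= (n%:R - contactD y)%:E)%E.
  by move=> /posE y0; rewrite lee_fin subr_ge0 contactD_le.
have intg : (\int[G]_(y in pos) `|(n%:R - contactD y)%:E|)%E = 0%E.
  under eq_integral => y /set_mem yp do rewrite gee0_abs ?g_ge0//.
  have : (\int[G]_(y in pos) ((n%:R - contactD y)%:E + (contactD y)%:E))%E = n%:R%:E.
    under eq_integral do rewrite -EFinD subrK.
    rewrite integral_cst//.
    by rewrite [X in (_ * X)%E](_ : _ = 1%E) ?mule1.
  rewrite ge0_integralD//; last 2 first.
  - by move=> y /posE y0; rewrite lee_fin contactD_ge0.
  - by apply/measurable_EFinP; exact: measurable_contactD.
  rewrite intDn => /(congr1 (fun z => z - n%:R%:E)%E).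
  by rewrite addeK// subee.
have negD := (ae_eq_integral_abs G measurable_pos mfg).1 intg.
have negpos : G.-negligible (~` pos).
  apply/negligibleP; first by apply: measurableC; exact: measurable_pos.
  rewrite /= (probability_setC G measurable_pos).
  by [rewrite [X in (_ - X)%E](_ : _ = 1%E) ?subee].
apply/negligibleP; first exact: measurableC.
apply: negligibleS (negligibleU negpos negD) => y NFy.
have [yp|] := pselect (pos y); last by left.
right => /= /(_ yp) [] /eqP; rewrite subr_eq0 eq_sym => /eqP Dy.
by apply: NFy; apply: contactF => //; apply/posE.
Qed.

End MixtureIntegrals.

(** * Measures with finite support *)

Section FiniteSupport.
Variable R : realType.
Implicit Types (G : probability (measurableTypeR R) R) (s : seq R).

Notation pos := (`]0%R, +oo[%classic : set (measurableTypeR R)).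

Lemma set_seq_bigsetU s : [set` s] = \big[setU/set0]_(y <- s) [set y].
Proof.
rewrite -bigcup_seq; apply/seteqP; split=> [y ys|y [z zs ->]//].
by exists y.
Qed.

Lemma measurable_set_seq s : measurable ([set` s] : set (measurableTypeR R)).
Proof. by rewrite set_seq_bigsetU; apply: bigsetU_measurable => y _; exact: measurable_set1. Qed.

Lemma finite_support_integral G s (D : set (measurableTypeR R)) (f : R -> \bar R) :
  uniq s -> measurable D -> [set` s] `<=` D -> G (~` [set` s]) = 0%E ->
  measurable_fun D f -> (forall y, D y -> (0 <= f y)%E) ->
  (\int[G]_(y in D) f y = \sum_(y <- s) f y * G [set y])%E.
Proof.
move=> s_uniq mD sD Gs mf f0.
have ms := measurable_set_seq s.
rewrite (@ge0_negligible_integral _ _ _ G D (~` [set` s]))//; last exact: measurableC.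
have -> : D `\` ~` [set` s] = \big[setU/set0]_(y <- s) [set y].
  by rewrite setDE setCK -set_seq_bigsetU; apply/setIidPr.
rewrite ge0_integral_bigsetU//.
- apply: eq_bigr => y _; rewrite -(integral_cst G (measurable_set1 y) (f y)).
  by apply: eq_integral => z; rewrite inE => ->.
- by move=> y z _ _ [u [->]].
- by apply: measurable_funS mf => //; rewrite -set_seq_bigsetU.
- by rewrite -set_seq_bigsetU => y /sD; exact: f0.
Qed.

Lemma finite_support_measure G s (A : set (measurableTypeR R)) : uniq s ->
  measurable A -> G (~` [set` s]) = 0%E ->
  G A = (\sum_(y <- s) (\1_A y)%:E * G [set y])%E.
Proof.
move=> s_uniq mA Gs.
rewrite -(@finite_support_integral G s setT (fun y => (\1_A y)%:E))//.
  by rewrite integral_indic// setIT.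
by apply/measurable_EFinP; exact: measurable_indic.
Qed.

Lemma atomic_probability n (w Y : 'I_n.+1 -> R) :
  (forall j, 0 <= w j) -> \sum_j w j = 1 -> (forall j, 0 < Y j) ->
  exists G, mixing G /\ forall k x, 0 <= x ->
    mixture k G x = (\sum_j w j * kern k x (Y j))%:E.
Proof.
move=> w0 w1 Y0.
pose m_ (j : nat) : {measure set (measurableTypeR R) -> \bar R} :=
  mscale (NngNum (w0 (inord j))) (@dirac _ (measurableTypeR R) (Y (inord j)) R).
pose mu : {measure set (measurableTypeR R) -> \bar R} := msum m_ n.+1.
have muE A : (forall j, A (Y j)) -> mu A = 1%E.
  move=> AY; rewrite /mu/= /msum/= (eq_bigr (fun j => (w j)%:E)) => [|j _].
    by rewrite sumEFin w1.
  by rewrite /mscale/= diracE inord_val mem_set// mule1.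
(* [mu] has mass 1, so the normalisation leaves it unchanged and only supplies the structure of a
   probability. *)
pose G : probability (measurableTypeR R) R := 
  mnormalize mu (@dirac _ (measurableTypeR R) 0 R).
have GE A : G A = mu A.
  by rewrite /G/= /mnormalize muE// onee_eq0/= invr1 mule1.
exists G; split; first by rewrite /mixing GE muE// => j; apply/posE.
move=> k x x0; rewrite mixtureE//.
rewrite (@eq_measure_integral _ _ _ _ mu) => [|A _ _]; last exact: GE.
have mk : measurable_fun pos (fun y => (kern k x y)%:E).
  by apply/measurable_EFinP; exact: measurable_kern.
have kp y : pos y -> (0 <= (kern k x y)%:E)%E.
  by move=> /posE/ltW y0; rewrite lee_fin kern_ge0.
rewrite ge0_integral_measure_sum//.
rewrite -sumEFin; apply: eq_bigr => j _.
rewrite ge0_integral_mscale// integral_dirac// diracE inord_val mem_set ?mul1e//.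
exact/posE.
Qed.

(** The complement of the finite set [s] without [y] is open, contains [y], and carries no mass
    except possibly at [y]. *)
Lemma msupport_finite G s : G (~` [set` s]) = 0%E ->
  msupport G = [set y | y \in s /\ (0 < G [set y])%E].
Proof.
move=> Gs; apply/seteqP; split=> [y suppy|y [ys Gy] U oU Uy]; last first.
  apply: (lt_le_trans Gy); apply: le_measure; rewrite ?inE.
  - exact: measurable_set1.
  - exact: open_measurable.
  - by move=> z ->.
have cl : closed ([set` s] `\ y).
  apply: (accessible_finite_set_closed.1 (hausdorff_accessible (@Rhausdorff R))).
  by apply: finite_setD; exact: finite_seq.
have GU : (0 < G (~` ([set` s] `\ y)))%E.
  by apply: suppy; [exact: closed_openC|case=> _; exact].
have ms := measurable_set_seq s.
have m1 : measurable ([set y] : set (measurableTypeR R)) by exact: measurable_set1.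
have Gy : (0 < G [set y])%E.
  apply: (lt_le_trans GU).
  have -> : G [set y] = (G [set y] + G (~` [set` s]))%E by rewrite Gs adde0.
  apply: le_trans (@measureU2 _ _ _ G _ _ m1 (measurableC ms)).
  apply: le_measure; rewrite ?inE.
  - by apply: measurableC; apply: measurableD.
  - by apply: measurableU => //; exact: measurableC.
  - move=> z Nz; have [zs|zs] := pselect ([set` s] z); last by right.
    by left; apply: contrapT => zy; apply: Nz.
split=> //; apply/negPn/negP => ys.
have : (G [set y] <= 0)%E.
  rewrite -Gs; apply: le_measure; rewrite ?inE//; first exact: measurableC.
  by move=> z ->; exact/negP.
by rewrite leNgt Gy.
Qed.

End FiniteSupport.

(** * Maximum likelihood *)

Section Deterministic.
Variables (R : realType) (n K : nat) (x : 'I_n -> R).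
Hypothesis n_gt0 : (0 < n)%N.
Hypothesis x_gt0 : forall i, 0 < x i.
Implicit Types (G : probability (measurableTypeR R) R).

(* In the variable [u = 1 / y] the kernel vanishes at [0] and for large [u], so
   the optimisation takes place on a compact interval. *)
Lemma optimal_mixture : exists p : 'I_n -> R, exists G,
  [/\ forall i, 0 < p i, forall y, 0 < y -> contactD K.+2 x p y <= n%:R,
      mixing G & forall i, mixture K.+2 G (x i) = (p i)%:E].
Proof.
pose f (i : 'I_n) (u : R) := u * g0 K.+2 (x i * u).
(* Beyond [U] every product [x i * u] is at least 1 and all the kernels vanish, which settles the
   contact inequality outside the compact interval. *)
pose U := \sum_i (x i)^-1.
have xU i : (x i)^-1 <= U.
  by rewrite /U (bigD1 i)//= lerDl sumr_ge0// => j _; rewrite invr_ge0 ltW.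
have f_ge0 i u : 0 <= u <= U -> 0 <= f i u.
  by move=> /andP[u0 _]; rewrite mulr_ge0// mulr_ge0// exprn_ge0// le_max lexx orbT.
(* [S] exceeds every data point, so all the kernels are positive at [S^-1]. *)
pose S := 1 + \sum_i x i.
have xS i : x i < S.
  rewrite /S (bigD1 i)//= addrCA ltrDl ltr_pwDl// sumr_ge0// => j _.
  exact: ltW.
have S0 : 0 < S by apply: lt_trans (xS (Ordinal n_gt0)).
have u0U : 0 <= S^-1 <= U.
  rewrite invr_ge0 ltW//=; apply: le_trans (xU (Ordinal n_gt0)).
  by rewrite lef_pV2 ?posrE// ltW.
have fu0 i : 0 < f i S^-1.
  rewrite mulr_gt0 ?invr_gt0// mulr_gt0 ?ltr0n// exprn_gt0// lt_max subr_gt0.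
  by rewrite ltr_pdivrMr// mul1r xS.
have [w [u [p [[w0 w1 uU] p0 pE slope contact]]]] :=
  optimizer_kkt (fun i => @continuous_kern_inv R K.+2 (x i)) f_ge0 n_gt0 u0U fu0.
(* Atoms of weight 0 are placed at 1. The others have [u j] nonzero, since all kernels vanish at
   [u = 0] whereas contact requires the positive value [n]. *)
pose Y j := if 0 < w j then (u j)^-1 else 1.
have u_gt0 j : 0 < w j -> 0 < u j.
  move=> wj; have /andP[uj _] := uU j; rewrite lt_neqAle uj andbT eq_sym.
  apply/eqP => uj0; have := contact j wj; rewrite uj0 big1 => [/eqP|i _].
    by rewrite eq_sym pnatr_eq0 (gtn_eqF n_gt0).
  by rewrite !mul0r.
have Y_gt0 j : 0 < Y j.
  by rewrite /Y; case: ifP => // /u_gt0; rewrite invr_gt0.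
have [G [mixG GE]] := atomic_probability w0 w1 Y_gt0.
exists p, G; split=> // [y y0|i].
  have [yU|yU] := leP y^-1 U.
    by apply: (slope y^-1); rewrite invr_ge0 ltW.
  rewrite /contactD big1 ?ler0n// => i _.
  rewrite /kern /g0 max_r ?expr0n/= ?mulr0 ?mul0r// subr_le0.
  by rewrite mulrC -ler_pdivrMr// div1r (le_trans (xU i))// ltW.
rewrite GE ?ltW// pE; congr EFin; apply: eq_bigr => j _; rewrite /Y; case: ifPn.
  by rewrite /kern invrK.
by rewrite -leNgt => wj; have -> : w j = 0; [apply/le_anti; rewrite wj w0|rewrite !mul0r].
Qed.

Variable p : 'I_n -> R.
Hypothesis p_gt0 : forall i, 0 < p i.
Hypothesis contactD_le : forall y, 0 < y -> contactD K.+2 x p y <= n%:R.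

(** The factorial of [K.+2] in both coefficients cancels the divisor of the leading term and leaves
    the kernel constant [K.+2] in front of the truncated powers. *)
Lemma contact_spline y : 0 < y ->
  spline (n%:R * K.+2`!%:R) (fun i => - (K.+2`!%:R / p i)) x K.+1 y =
  y ^+ K.+2 * (n%:R - contactD K.+2 x p y).
Proof.
move=> y0; have fN m : m`!%:R != 0 :> R by rewrite pnatr_eq0 -lt0n fact_gt0.
have yN : y ^+ K.+2 != 0 by rewrite expf_neq0// gt_eqF.
rewrite /spline mulrBr; congr (_ + _).
  by field.
rewrite /contactD mulr_sumr -sumrN; apply: eq_bigr => i _; rewrite kernE//.
rewrite factS natrM; have := fN K.+1; have := p_gt0 i.
move: (K.+1)`!%:R (tpow _ _) (y ^+ K.+2) yN => a b c cN /lt0r_neq0 pN aN.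
by field; rewrite pN cN aN.
Qed.

Lemma contact_indep m (Y c : 'I_m -> R) :
  {homo Y : i j / (i < j)%N >-> i < j} ->
  (forall j, 0 < Y j /\ contactD K.+2 x p (Y j) = n%:R) ->
  (forall i, \sum_j c j * tpow K.+1 (Y j - x i) = 0) -> forall j, c j = 0.
Proof.
move=> Y_incr YP dep.
pose ext (g : 'I_m -> R) (j : nat) := if insub j is Some l then g l else 0.
have extE g (j : 'I_m) : ext g j = g j by rewrite /ext valK.
have extE' g j (jm : (j < m)%N) : ext g j = g (Ordinal jm) by rewrite -extE.
have q_gt0 : 0 < n%:R * K.+2`!%:R :> R by rewrite mulr_gt0// ltr0n// fact_gt0.
have b_ge0 i : 0 <= K.+2`!%:R / p i by rewrite divr_ge0// ltW.
have h_ge0 y : 0 < y -> 0 <=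
    spline (n%:R * K.+2`!%:R) (fun i => - (K.+2`!%:R / p i)) x K.+1 y.
  by move=> y0; rewrite contact_spline// mulr_ge0 ?exprn_ge0 ?(ltW y0)// subr_ge0 contactD_le.
have := @contact_independent R _ _ _ x K q_gt0 b_ge0 x_gt0 h_ge0 m (ext Y) (ext c).
move=> indep j; rewrite -extE; apply: indep => // [l lm|l lm|i].
- by rewrite (extE' _ _ lm) (extE' _ _ (ltnW lm)) Y_incr.
- have [Y0 DY] := YP (Ordinal lm).
  by rewrite (extE' _ _ lm) contact_spline// DY subrr mulr0.
- by rewrite -[RHS](dep i); apply: eq_bigr => l _; rewrite !extE.
Qed.

Lemma contact_size m (Y : 'I_m -> R) :
  {homo Y : i j / (i < j)%N >-> i < j} ->
  (forall j, 0 < Y j /\ contactD K.+2 x p (Y j) = n%:R) -> (m <= n)%N.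
Proof.
move=> Y_incr YP; rewrite leqNgt; apply/negP => nm.
have [v [[l vl] dep]] := underdetermined (fun j i => tpow K.+1 (Y j - x i)) nm.
by move: vl; rewrite (contact_indep Y_incr YP dep) eqxx.
Qed.

Lemma sorted_homo (s : seq R) : sorted <%R s ->
  {homo (fun j : 'I_(size s) => nth 0 s j) : i j / (i < j)%N >-> i < j}.
Proof.
by move=> ss i j ij; apply: (sorted_ltn_nth lt_trans 0 ss); rewrite ?inE.
Qed.

(** By [contact_size] every finite subset of the contact set has at most [n] elements, so this set
    is itself finite. *)
Lemma contact_seq : exists s : seq R,
  [/\ sorted <%R s, (size s <= n)%N &
      forall y, y \in s <-> 0 < y /\ contactD K.+2 x p y = n%:R].
Proof.
pose C := [set y : R | 0 < y /\ contactD K.+2 x p y = n%:R].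
have sizeC (t : seq R) : uniq t -> (forall y, y \in t -> C y) -> (size t <= n)%N.
  move=> tu tC.
  have st : sorted <%R (sort <=%R t).
    by rewrite lt_sorted_uniq_le sort_uniq tu sort_le_sorted.
  rewrite -(size_sort <=%R t).
  apply: (contact_size (sorted_homo st)) => j; apply: tC.
  by rewrite -(mem_sort <=%R) mem_nth.
have finC : finite_set C.
  apply: contrapT => /(infinite_set_fset n.+1)[B BC nB].
  by have := sizeC (finmap.enum_fset B) (finmap.fset_uniq B) BC; rewrite leqNgt nB.
have [t tC] := (finite_seqP C).1 finC.
exists (sort <=%R (undup t)); split.
- by rewrite lt_sorted_uniq_le sort_uniq undup_uniq sort_le_sorted.
- rewrite size_sort; apply: sizeC; first exact: undup_uniq.
  by move=> y; rewrite mem_undup tC.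
- by move=> y; rewrite mem_sort mem_undup; change ([set` t] y <-> C y); rewrite -tC.
Qed.

Lemma mixture_finite_support G s : uniq s -> (forall y, y \in s -> 0 < y) ->
  G (~` [set` s]) = 0%E -> forall i,
  mixture K.+2 G (x i) = (\sum_(y <- s) (kern K.+2 (x i) y)%:E * G [set y])%E.
Proof.
move=> su s0 Gs i; rewrite mixtureE ?(ltW (x_gt0 i))//.
apply: finite_support_integral => //.
- by move=> y /s0 y0; apply/posE.
- by apply/measurable_EFinP; exact: measurable_kern.
- by move=> y /posE/ltW y0; rewrite lee_fin kern_ge0.
Qed.

(** Both measures are carried by the finite contact set, and the differences of their weights give a
    vanishing combination of independent vectors. *)
Lemma mixing_unique G G' : mixing G -> mixing G' ->
  (forall i, mixture K.+2 G (x i) = (p i)%:E) ->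
  (forall i, mixture K.+2 G' (x i) = (p i)%:E) ->
  forall A : set (measurableTypeR R), measurable A -> G A = G' A.
Proof.
move=> mG mG' GE G'E A mA; have [s [ss _ sP]] := contact_seq.
have su : uniq s by apply: (sorted_uniq lt_trans ltxx).
have s0 y : y \in s -> 0 < y by move=> /sP[].
have contactF y : 0 < y -> contactD K.+2 x p y = n%:R -> [set` s] y.
  by move=> y0 Dy; apply/sP.
have Gs := contact_mass x_gt0 p_gt0 contactD_le mG GE (measurable_set_seq s) contactF.
have G's := contact_mass x_gt0 p_gt0 contactD_le mG' G'E (measurable_set_seq s) contactF.
rewrite !(finite_support_measure su mA)//; apply: eq_big_seq => y ys; congr (_ * _)%E.
pose g (H : probability (measurableTypeR R) R) (y : R) := fine (H [set y]).
have gE (H : probability (measurableTypeR R) R) z : H [set z] = (g H z)%:E.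
  by rewrite fineK// fin_num_measure//; exact: measurable_set1.
(* The second factor turns the kernels into the truncated powers of [contact_indep]. *)
pose c (j : 'I_(size s)) := (g G (nth 0 s j) - g G' (nth 0 s j)) *
  (K.+2%:R / nth 0 s j ^+ K.+2).
have sj (j : 'I_(size s)) : 0 < nth 0 s j by apply/s0/mem_nth.
have c0 j : c j = 0.
  apply: (@contact_indep _ (fun j => nth 0 s j)); first exact: sorted_homo.
    by move=> l; apply/sP/mem_nth.
  move=> i.
  have mixE (H : probability (measurableTypeR R) R) : H (~` [set` s]) = 0%E ->
      mixture K.+2 H (x i) = (p i)%:E ->
      \sum_(l < size s) kern K.+2 (x i) (nth 0 s l) * g H (nth 0 s l) = p i.
    move=> Hs HE; apply: EFin_inj; rewrite -HE (mixture_finite_support su)//.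
    rewrite (big_nth 0) big_mkord -sumEFin; apply: eq_bigr => l _.
    by rewrite gE.
  transitivity (p i - p i); last exact: subrr.
  rewrite -[X in X - _](mixE G)// -[X in _ - X](mixE G')// -sumrB.
  by apply: eq_bigr => l _; rewrite /c kernE//; ring.
have ix : (index y s < size s)%N by rewrite index_mem.
move: (c0 (Ordinal ix)); rewrite /c/= nth_index// => /eqP.
rewrite mulf_eq0 mulf_eq0 pnatr_eq0/= invr_eq0 expf_eq0/= (gt_eqF (s0 y ys)) orbF.
by rewrite subr_eq0 !gE => /eqP->.
Qed.

Lemma seq_max (s : seq R) : s != [::] ->
  exists2 M, M \in s & forall y, y \in s -> y <= M.
Proof.
elim: s => // a [|b s] IH _; first by exists a; rewrite ?inE// => y; rewrite inE => /eqP->.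
have [M Ms ME] := IH isT; have [aM|Ma] := leP a M.
  exists M; first by rewrite inE Ms orbT.
  by move=> y; rewrite inE => /predU1P[->//|]; exact: ME.
exists a; first by rewrite inE eqxx.
move=> y; rewrite inE => /predU1P[->//|ys].
exact: le_trans (ME y ys) (ltW Ma).
Qed.

End Deterministic.

(** * Order statistics, positivity of the data, and the conclusion *)

Section OrderStatistics.
Variables (R : realType) (n : nat) (x : 'I_n -> R).

Lemma size_sort_codom : size (sort <=%R (codom x)) = n.
Proof. by rewrite size_sort size_codom card_ord. Qed.

Lemma order_stat_nondecr : {homo order_stat x : i j / (i <= j)%N >-> i <= j}.
Proof.
move=> i j ij; apply: (sorted_leq_nth le_trans lexx) => //.
- exact: sort_le_sorted.
- by rewrite inE size_sort_codom.
- by rewrite inE size_sort_codom.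
Qed.

Lemma order_stat_mem i : exists j, order_stat x i = x j.
Proof.
have : order_stat x i \in codom x.
  by rewrite -(mem_sort <=%R) mem_nth// size_sort_codom.
by move=> /codomP.
Qed.

Lemma order_stat_onto j : exists i, x j = order_stat x i.
Proof.
have xj : x j \in sort <=%R (codom x) by rewrite mem_sort codom_f.
have ix : (index (x j) (sort <=%R (codom x)) < n)%N.
  by rewrite -[ltnRHS]size_sort_codom index_mem.
by exists (Ordinal ix); rewrite /order_stat/= nth_index.
Qed.

End OrderStatistics.

(** The density vanishes on the negative half-line, and the origin is a Lebesgue null set. *)
Lemma density_gt0_ae (R : realType) (d : measure_display) (T : measurableType d)
    (P : probability T R) (k : nat) (f0 : R -> \bar R)
    (X : {RV P >-> measurableTypeR R}) :
  kmonotone k f0 -> has_density X f0 -> {ae P, forall w, 0 < X w}.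
Proof.
move=> [G0 _ f0E] dens.
have neg A (mA : measurable (A : set (measurableTypeR R))) :
    (\int[lebesgue_measure]_(y in A) f0 y)%E = 0%E -> P.-negligible (X @^-1` A).
  move=> intA; apply/negligibleP.
    by rewrite -[X in measurable X]setTI; exact: measurable_funPT.
  by have := dens A mA; rewrite intA.
have neg1 : P.-negligible (X @^-1` [set 0]).
  by apply: neg; [exact: measurable_set1|exact: integral_set1].
have neg2 : P.-negligible (X @^-1` `]-oo, 0%R[%classic).
  apply: neg; first exact: measurable_itv.
  apply: integral0_eq => y; rewrite /= in_itv/= => y0.
  by rewrite f0E /mixture leNgt y0.
apply: negligibleS (negligibleU neg1 neg2) => w /= /negP; rewrite -leNgt le_eqVlt.
by case/predU1P => [->|X0]; [left|right; rewrite /= in_itv/=].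
Qed.

Theorem theorem1p1 (R : realType) (d : measure_display) (T : measurableType d)
    (P : probability T R) (k n : nat) (hk : (2 <= k)%N) (hn : (0 < n)%N)
    (f0 : R -> \bar R) (hf0 : kmonotone k f0)
    (X : 'I_n -> {RV P >-> measurableTypeR R})
    (hindep : mutually_independent X)
    (hdens : forall i : 'I_n, has_density (X i) f0) :
  {ae P, forall w : T,
    let x : 'I_n -> R := fun i => X i w in
    exists fhat : R -> \bar R,
      [/\ is_mle k x fhat,
          (forall g : R -> \bar R, is_mle k x g -> g = fhat) &
          exists Ghat : probability (measurableTypeR R) R,
            [/\ [/\ mixing Ghat, fhat = mixture k Ghat & discrete_measure Ghat],
                (forall G : probability (measurableTypeR R) R,
                   mixing G -> fhat = mixture k G ->
                   forall A : set (measurableTypeR R),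
                     measurable A -> G A = Ghat A),
                (msupport Ghat #<= `I_n)%card,
                (forall (m : nat) (Y : 'I_m -> R),
                   (m < n)%N ->
                   {homo Y : j j' / (j < j')%N >-> j < j'} ->
                   msupport Ghat = range Y ->
                   exists i : 'I_m -> 'I_n,
                     [/\ {homo i : j j' / (j < j')%N},
                         {homo (fun j => order_stat x (i j)) :
                            j j' / (j < j')%N >-> j < j'} &
                         forall j : 'I_m,
                           order_stat x (i j) < Y j /\
                           ((Y j)%:E < order_stat_sub x i (j + k))%E]) &
                exists Ymax : R,
                  [/\ msupport Ghat Ymax,
                      (forall y : R, msupport Ghat y -> y <= Ymax) &
                      forall r : 'I_n, val r = n.-1 -> order_stat x r < Ymax]]]}.
Proof.
have : {ae P, forall w, forall i, 0 < X i w}.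
  by apply: filter_forall => i; exact: density_gt0_ae hf0 (hdens i).
apply: filterS => w Xw_gt0; set x := fun i : 'I_n => _.
have x_gt0 : forall i, 0 < x i := Xw_gt0.
case: k hk {hf0} => [|[|K]]// _.
have [p [Ghat [p_gt0 contactD_le mixGhat GhatE]]] := optimal_mixture K hn x_gt0.
have [s [s_sorted s_size sP]] := contact_seq hn x_gt0 p_gt0 contactD_le.
have s_uniq : uniq s by apply: (sorted_uniq lt_trans ltxx).
have s_gt0 y : y \in s -> 0 < y by move=> /sP[].
have Ghat_s : Ghat (~` [set` s]) = 0%E.
  apply: (contact_mass x_gt0 p_gt0 contactD_le mixGhat GhatE (measurable_set_seq s)).
  by move=> y y0 Dy; apply/sP.
have suppE := msupport_finite Ghat_s.
have uniqueG G : mixing G -> (forall i, mixture K.+2 G (x i) = (p i)%:E) ->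
    forall A : set (measurableTypeR R), measurable A -> G A = Ghat A.
  by move=> mixG GE; exact: (mixing_unique hn x_gt0 p_gt0 contactD_le).
have prodGhat : (\prod_(i < n) mixture K.+2 Ghat (x i) = (\prod_(i < n) p i)%:E)%E.
  by rewrite -prodEFin; apply: eq_bigr => i _; rewrite GhatE.
exists (mixture K.+2 Ghat); split.
- split; first by exists Ghat.
  move=> _ [G mixG ->].
  have [m [mE m0 m_le _]] := mixture_values x_gt0 p_gt0 contactD_le mixG.
  rewrite prodGhat (eq_bigr (fun i => (m i)%:E)) => [|i _]; last exact: mE.
  by rewrite prodEFin lee_fin (agm_ratio hn m0 p_gt0 m_le).1.
(* The values of another maximiser have a product at least that of [p]; the equality case of
   [agm_ratio] makes them equal to [p], which determines the mixing measure. *)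
- move=> _ [[G mixG ->] Gmax].
  have [m [mE m0 m_le _]] := mixture_values x_gt0 p_gt0 contactD_le mixG.
  have : (\prod_(i < n) p i <= \prod_(i < n) m i).
    rewrite -lee_fin -prodGhat -prodEFin.
    rewrite [leRHS](eq_bigr (fun i => mixture K.+2 G (x i))) => [|i _]; last by rewrite mE.
    by apply: Gmax; exists Ghat.
  move=> /(agm_ratio hn m0 p_gt0 m_le).2 mp.
  by apply: eq_mixture => A mA; apply: uniqueG => // i; rewrite mE mp.
exists Ghat; split.
- split=> //; exists [set` s] => //.
  exact/finite_set_countable/finite_seq.
- by move=> G mixG eqf; apply: uniqueG => // i; rewrite -eqf GhatE.
- apply: card_le_trans (_ : ([set` s] #<= `I_n)%card).
    by apply: subset_card_le; rewrite suppE => y [].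
  have -> : [set` s] = nth 0 s @` `I_(size s).
    apply/seteqP; split=> [y ys|_ [j js <-]]; last exact: mem_nth.
    by exists (index y s); [rewrite /= index_mem|rewrite nth_index].
  apply: (card_le_trans (card_image_le _ _)); apply: subset_card_le => j /= js.
  exact: leq_trans s_size.
- move=> m Y _ Y_incr rangeY.
  have Ys j : Y j \in s.
    by have : msupport Ghat (Y j); [rewrite rangeY; exists j|rewrite suppE => -[]].
  have [|i [i_incr Xi_incr iP]] := @interlacing R n m K (order_stat x) Y
    (@order_stat_nondecr _ _ x) Y_incr.
    move=> c dep; apply: (contact_indep hn x_gt0 p_gt0 contactD_le Y_incr).
      by move=> j; apply/sP.
    by move=> l; have [i ->] := order_stat_onto x l.
  exists i; split=> // j; have [h1 h2] := iP j; split=> //.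
  (* An index [j + k] beyond the last one gives the value +oo by convention. *)
  rewrite /order_stat_sub; case: insubP => [l _ lE|_]; last exact: ltry.
  by rewrite lte_fin; apply: h2.
(* If no atom exceeded [x i], every kernel in the sum would vanish at [x i] and [p i] would be 0. *)
have above i : exists2 y, y \in [seq y <- s | (0 < Ghat [set y])%E] & x i < y.
  apply: contrapT => noy.
  have := GhatE i; rewrite (mixture_finite_support K x_gt0 s_uniq)// big_seq big1.
    by case=> /esym pi0; have := p_gt0 i; rewrite pi0 ltxx.
  move=> y ys; have [Gy|Gy] := ltP 0%E (Ghat [set y]); last first.
    have -> : Ghat [set y] = 0%E by apply/le_anti; rewrite Gy measure_ge0.
    by rewrite mule0.
  have -> : kern K.+2 (x i) y = 0; last by rewrite mul0e.
  apply/le_anti; rewrite kern_ge0 ?(ltW (s_gt0 y ys))// andbT leNgt kern_gt0 ?s_gt0//.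
  by apply/negP => xy; apply: noy; exists y => //; rewrite mem_filter Gy.
have [|Ymax] := @seq_max R [seq y <- s | (0 < Ghat [set y])%E].
  by have [y ys _] := above (Ordinal hn); apply/eqP => s_nil; rewrite s_nil in ys.
rewrite mem_filter => /andP[GY Ys] Ymax_ge.
have suppY y : msupport Ghat y -> y \in [seq y <- s | (0 < Ghat [set y])%E].
  by rewrite suppE => -[ys Gy]; rewrite mem_filter Gy.
exists Ymax; split=> [|y /suppY|r _]; [by rewrite suppE|exact: Ymax_ge|].
have [j ->] := order_stat_mem x r; have [y ys xy] := above j.
exact: lt_le_trans xy (Ymax_ge y ys).
Qed.
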